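(* Let $G$ be a connected bipartite graph with vertex bipartition $V_1\sqcup V_2$ and let $\vec G$ be the orientation of $G$ in which every edge is directed from its vertex in $V_1$ to its vertex in $V_2$. Then the sequence of coefficients of the polynomial $f_{M_{\vec G}}(t)$ is log-concave. In particular, it is trapezoidal.
   Context: Graphs are finite. The column of the signed incidence matrix $I(\vec G)$ indexed by an edge $e$ from $i\in V_1$ to $j\in V_2$ is $a_e=\mathbf{e}_i-\mathbf{e}_j\in\mathbb{R}^{V(G)}$. The associated matroid on $E(G)$ has the spanning trees of $G$ as bases and the edge sets of cycles of $G$ as circuits. For a circuit $C$ let $\sum_{e\in C}\lambda_e a_e=0$ be the linear dependence with all $\lambda_e\neq 0$, unique up to nonzero scalar; set $\lambda_e=0$ for $e\notin C$ to get $\lambda_C\in\mathbb{R}^{E(G)}$. A vector $\rho\in\mathbb{R}^{E(G)}$ is generic if $(\lambda_C,\rho)\ne0$ for all circuits $C$; for a fixed generic $\rho$ scale so that $(\lambda_C,\rho)>0$ and put $C^+=\{e\in C:\lambda_e>0\}$. For a spanning tree $T$, $\mathrm{ext}_\rho(T)$ is the number of edges $e\notin T$ with $e\in C^+$, where $C$ is the unique cycle in $T\cup\{e\}$. Then $$f_{M_{\vec G}}(t)=\sum_{T}t^{\mathrm{ext}_\rho(T)},$$ summed over all spanning trees $T$ of $G$. This is known not to depend on the generic $\rho$. (It is the instance, for this unimodular configuration, of the general polynomial $f_A(t)=\sum_B t^{\mathrm{ext}_\rho(B)}\mathrm{Vol}(\Pi_B)$, all volumes being $1$.) For a polynomial $f(t)=\sum_{i=0}^n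 a_it^i$ of degree $n$, the sequence of coefficients $a_0,\dots,a_n$ is log-concave if $a_i^2\ge a_{i-1}a_{i+1}$ for $0<i<n$, and trapezoidal if $a_0<a_1<\cdots<a_k=a_{k+1}=\cdots=a_m>a_{m+1}>\cdots>a_n$ for some $0\le k\le m\le n$. *)

(* Defs.v *)
From HB Require Import structures.
From mathcomp Require Import all_boot all_order all_algebra.
From mathcomp Require Import boolp reals.

Set Implicit Arguments.
Unset Strict Implicit.
Unset Printing Implicit Defensive.

Import Order.TTheory GRing.Theory Num.Theory.

Local Open Scope ring_scope.

(* A finite graph together with an orientation; [edge] is an abstract type, so
   parallel edges are allowed.  Connectedness, cycles and spanning trees below
   are those of the underlying undirected graph. *)
Record digraph := Digraph {
  vert : finType;
  edge : finType;
  source : edge -> vert;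
  target : edge -> vert }.

Section Graph.
Variable G : digraph.
Implicit Types (F C T : {set edge G}) (e : edge G) (u v : vert G).

Definition joins e u v : bool :=
  ((source e == u) && (target e == v)) || ((source e == v) && (target e == u)).

Definition adjacent F : rel (vert G) :=
  fun u v => [exists e in F, joins e u v].

(* The graph without vertices is not connected. *)
Definition connected_by F : Prop :=
  (0 < #|vert G|)%N /\ forall u v, connect (adjacent F) u v.

Definition connected_graph : Prop := connected_by [set: edge G].

Definition directed_bipartition (V1 V2 : {set vert G}) : Prop :=
  [/\ V1 :|: V2 = [set: vert G], [disjoint V1 & V2] &
      forall e, (source e \in V1) /\ (target e \in V2)].

(* [C] is the edge set of a cycle w_0 -c_0- w_1 -c_1- ... -c_k- w_0 with
   distinct vertices and distinct edges; [ordS] is the cyclic successor.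
   Injectivity of [c] only matters for k = 1 (two parallel edges). *)
Definition is_cycle C : Prop :=
  exists (k : nat) (w : 'I_k.+1 -> vert G) (c : 'I_k.+1 -> edge G),
    [/\ injective w, injective c,
        forall i, joins (c i) (w i) (w (ordS i)) &
        C = [set c i | i : 'I_k.+1]].

Definition spanning_tree T : Prop :=
  connected_by T /\ forall C, is_cycle C -> ~~ (C \subset T).

Section RealVectors.
Variable R : realType.
Implicit Types lam rho : {ffun edge G -> R}.

(* The column of the signed incidence matrix indexed by [e]. *)
Definition incidence_col e : {ffun vert G -> R^o} :=
  [ffun v => (v == source e)%:R - (v == target e)%:R].

Definition dependence C lam : Prop :=
  (forall e, (lam e != 0) = (e \in C)) /\
  \sum_e lam e *: incidence_col e = 0.

Definition dot lam rho : R := \sum_e lam e * rho e.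

Definition generic rho : Prop :=
  forall C lam, is_cycle C -> dependence C lam -> dot lam rho != 0.

(* For a cycle [C] the dependence is unique up to a nonzero scalar, so once it
   is scaled to pair positively with a generic [rho], the signs of its
   coordinates do not depend on the [lam] chosen. *)
Definition pos_part rho C : {set edge G} :=
  [set e in C | `[< exists lam,
     [/\ dependence C lam, 0 < dot lam rho & 0 < lam e] >]].

(* When [T] is a spanning tree and e \notin T, there is exactly one cycle
   contained in [e |: T]. *)
Definition ext rho T : nat :=
  #|[set e | (e \notin T) &&
     `[< exists C, [/\ is_cycle C, C \subset e |: T & e \in pos_part rho C] >]]|.

(* The polynomial f, computed with [rho]; its value is the same for all generic
   [rho]. *)
Definition f_poly rho : {poly int} :=
  \sum_(T : {set edge G} | `[< spanning_tree T >]) 'X^(ext rho T).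

End RealVectors.
End Graph.

Section Coefficients.
Variables (K : numDomainType) (p : {poly K}).

Definition log_concave : Prop :=
  forall i : nat, (0 < i < (size p).-1)%N -> p`_i.-1 * p`_i.+1 <= p`_i ^+ 2.

Definition trapezoidal : Prop :=
  exists k m : nat,
    [/\ (k <= m <= (size p).-1)%N,
        forall i, (i < k)%N -> p`_i < p`_i.+1,
        forall i, (k <= i < m)%N -> p`_i = p`_i.+1 &
        forall i, (m <= i < (size p).-1)%N -> p`_i.+1 < p`_i].

End Coefficients.

(* Main.v *)
(* Sending each spanning tree T to the vector that counts, at every vertex, the edges e outside
   T whose chosen endpoint it is (the source if e is externally active, the target otherwise) is
   a bijection onto the "break vectors" q: those with sum |E| - |V| + 1 and
   q(S) + |S| <= #{edges meeting S} for every proper vertex set S.  Indeed the sum over T of the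
   segments [source, target], translated by this vector, is a tile of the regular tiling of the
   graphical zonotope induced by rho: the flows of value |V| q(v) + |V| - 1 at v have a unique
   rho-maximal member, whose fractional edges form the tree.  Hence the i-th coefficient of f is
   the number N_i of break vectors with q(V1) = i.

   Break vectors form an M-convex set J.  With F = sum_{c in J} x^c / c!, the Dirichlet integral of
   F over the product of simplices s.Delta_{V1} x t.Delta_{V2} is, writing r1 = |V1| and
   r2 = |V2|, the sum of N_{i} s^(i+r1-1) t^(j+r2-1) / ((i+r1-1)! (j+r2-1)!), i + j = |E|-|V|+1.
   Differentiating the integral along s.Delta_P - x_v restricts it to the facet P \ v, and
   differentiating along x_v replaces J by its contraction, so that all these integrals form a
   family closed under enough derivatives for the inductive proof of the Hodge-Riemann
   (Alexandrov-Fenchel) inequality: a quadratic form which is a positive combination of Lorentzian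
   forms attached to its facets is itself Lorentzian.  Log-concavity of N is the 2 x 2 minor in
   the directions s and t. *)

Require Import Defs.
From HB Require Import structures.
From mathcomp Require Import all_boot all_order all_algebra.
From mathcomp Require Import boolp reals.
From mathcomp Require Import zify ring lra.

Set Implicit Arguments.
Unset Strict Implicit.
Unset Printing Implicit Defensive.

Import Order.TTheory GRing.Theory Num.Theory.

Local Open Scope ring_scope.

(** * The local-to-global principle *)

(** The integrals are never formed: [polar] evaluates their derivatives as counts of vectors, and
    the facet rule becomes a case split on one coordinate. An integral has degree [d + r1 + r2 - 2],
    which is the origin of the constants 2, 4 and 5 in the size hypotheses. The Hessian is taken in
    the redundant family of all contractions and facets, because there a positive direction has
    positive coordinates at all active indices and the off-diagonal entries are nonnegative. The
    spectral step needs these entries to connect the active indices; M-convexity serves there and in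
    the quadratic base case. The directions s and t lie on the boundary of the positive cone, hence
    a final perturbation and limit. On the graph side, the demand [|V| q(v) + |V| - 1] is [q + 1]
    lowered by [1/|V|] at every vertex and rescaled to integers. Over a vertex set [S] it is
    congruent to [-|S|] modulo [|V|], so a proper nonempty cut is never crossed by saturated and
    empty edges alone; this makes the fractional edges of an optimal flow connected, and genericity
    makes them acyclic. *)

Section LocalGlobal.
Variables (K : realFieldType) (I : finType).

Lemma psd_cauchy_schwarz (b : I -> I -> K) (x y : I -> K) :
  (forall i j, b i j = b j i) ->
  (forall u : I -> K, 0 <= \sum_i \sum_j b i j * u i * u j) ->
  (\sum_i \sum_j b i j * x i * y j) ^+ 2 <=
  (\sum_i \sum_j b i j * x i * x j) * (\sum_i \sum_j b i j * y i * y j).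
Proof.
move=> bC b_ge0.
set X := \sum_i \sum_j b i j * x i * x j.
set Y := \sum_i \sum_j b i j * y i * y j.
set Z := \sum_i \sum_j b i j * x i * y j.
have Z' : \sum_i \sum_j b i j * y i * x j = Z.
  rewrite exchange_big; apply: eq_bigr => i _; apply: eq_bigr => j _.
  by rewrite bC mulrAC.
have key s t : 0 <= s ^+ 2 * X + 2 * s * t * Z + t ^+ 2 * Y.
  have := b_ge0 (fun i => s * x i + t * y i).
  suff -> : \sum_i \sum_j b i j * (s * x i + t * y i) * (s * x j + t * y j) =
    s ^+ 2 * X + s * t * Z + s * t * (\sum_i \sum_j b i j * y i * x j) + t ^+ 2 * Y.
    by rewrite Z'; congr (0 <= _); ring.
  rewrite !mulr_sumr -!big_split; apply: eq_bigr => i _ /=.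
  rewrite !mulr_sumr -!big_split; apply: eq_bigr => j _ /=.
  by ring.
have Y0 : 0 <= Y by have := key 0 1; lra.
have X0 : 0 <= X by have := key 1 0; lra.
have [Yz|Yn] := eqVneq Y 0.
  (* With [Y] = 0 this instance reads [0 <= - Z^2 (X + 2)], which forces [Z] = 0. *)
  have := key (- (Z)) (X + 1); rewrite Yz; nra.
have Yp : 0 < Y by rewrite lt_def Yn.
have : 0 <= Y * (X * Y - Z ^+ 2) by have := key Y (- Z); congr (0 <= _); ring.
by rewrite pmulr_rge0 // subr_ge0.
Qed.

(** The Dirichlet form of a weighted graph. The diagonal of [a] cancels, so its sign is decided by
    the off-diagonal weights. *)
Lemma laplacian_form (a : I -> I -> K) (u : I -> K) :
  (forall i j, a i j = a j i) ->
  \sum_i (\sum_j a i j) * u i ^+ 2 - \sum_i \sum_j a i j * u i * u j =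
  2^-1 * \sum_i \sum_j a i j * (u i - u j) ^+ 2.
Proof.
move=> aC.
have E : \sum_i \sum_j a i j * (u i - u j) ^+ 2 =
   \sum_i \sum_j a i j * u i ^+ 2 + \sum_i \sum_j a i j * u j ^+ 2
   - 2 * \sum_i \sum_j a i j * u i * u j.
  rewrite mulr_sumr -sumrN -!big_split; apply: eq_bigr => i _ /=.
  rewrite mulr_sumr -sumrN -!big_split; apply: eq_bigr => j _ /=.
  by ring.
have E2 : \sum_i \sum_j a i j * u j ^+ 2 = \sum_i \sum_j a i j * u i ^+ 2.
  by rewrite exchange_big; apply: eq_bigr => i _; apply: eq_bigr => j _; rewrite aC.
have E3 : \sum_i (\sum_j a i j) * u i ^+ 2 = \sum_i \sum_j a i j * u i ^+ 2.
  by apply: eq_bigr => i _; rewrite mulr_suml.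
by rewrite E E2 E3; lra.
Qed.

(** The Fredholm alternative: a row space is cut out by the cokernel, whose columns are kernel
    vectors of [L]; symmetry turns row combinations into a solution. *)
Lemma symmetric_solve (L : I -> I -> K) (w : I -> K) :
  (forall i j, L i j = L j i) ->
  (forall z, (forall i, \sum_j L i j * z j = 0) -> \sum_i w i * z i = 0) ->
  exists v, forall i, \sum_j L i j * v j = w i.
Proof.
move=> LC orth.
pose M := \matrix_(p < #|I|, q < #|I|) L (enum_val p) (enum_val q).
pose W := \row_(q < #|I|) w (enum_val q).
have E (F : I -> K) : \sum_i F i = \sum_(p < #|I|) F (enum_val p).
  exact: (reindex (@enum_val I xpredT)) (onW_bij _ (@enum_val_bij I)).
have : (W <= M)%MS.
  rewrite submxE; apply/eqP/matrixP => p q; rewrite [LHS]mxE [RHS]mxE.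
  have := mulmx_coker M; move: (cokermx M) => C MC.
  pose z i := C (enum_rank i) q.
  rewrite -[RHS](orth z) => [|i].
    by rewrite E; apply: eq_bigr => r _; rewrite mxE /z enum_valK.
  have := congr1 (fun A : 'M_ _ => A (enum_rank i) q) MC.
  rewrite [LHS]mxE [RHS]mxE => Mz; rewrite -[RHS]Mz E.
  by apply: eq_bigr => r _; rewrite mxE /z enum_valK enum_rankK.
case/submxP => D WD.
exists (fun i => D 0 (enum_rank i)) => i.
have := congr1 (fun A : 'M_ _ => A 0 (enum_rank i)) WD; rewrite !mxE enum_rankK => ->.
rewrite E; apply: eq_bigr => r _.
by rewrite !mxE enum_valK enum_rankK mulrC LC.
Qed.

(* The eigenvalue form of the hypothesis is A <= A ^ 2 for A = diag(r)^-1 a, whose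
   top eigenvalue is 1 with the constants as eigenvectors; the Laplacian
   diag(r) - a then has no eigenvalue strictly between 0 and 1. *)
Lemma local_to_global (a : I -> I -> K) (u : I -> K) :
  let r i := \sum_j a i j in
  (forall i j, a i j = a j i) ->
  (forall i j, i != j -> 0 <= a i j) ->
  (forall i, 0 < r i \/ forall j, a i j = 0) ->
  (forall f : I -> K, (forall i j, i != j -> 0 < a i j -> f i = f j) ->
     forall i j, 0 < r i -> 0 < r j -> f i = f j) ->
  (forall x : I -> K, \sum_i \sum_j a i j * x i * x j <=
     \sum_i (\sum_j a i j * x j) ^+ 2 / r i) ->
  \sum_i r i * u i = 0 -> \sum_i \sum_j a i j * u i * u j <= 0.
Proof.
move=> r aC a_ge0 r_pos conn H ru0.
pose L i j := (i == j)%:R * r i - a i j.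
have LC i j : L i j = L j i.
  by rewrite /L aC eq_sym; case: eqP => [->|]; rewrite ?mul1r ?mul0r.
have Lx (x : I -> K) i : \sum_j L i j * x j = r i * x i - \sum_j a i j * x j.
  under eq_bigr do rewrite /L mulrBl.
  rewrite sumrB; congr (_ - _).
  rewrite (bigD1 i) //= eqxx mul1r big1 ?addr0 // => j /negPf ij.
  by rewrite eq_sym ij !mul0r.
have Lxx (x y : I -> K) : \sum_i \sum_j L i j * x i * y j =
    \sum_i r i * x i * y i - \sum_i \sum_j a i j * x i * y j.
  rewrite -sumrB; apply: eq_bigr => i _.
  have -> : \sum_j L i j * x i * y j = x i * \sum_j L i j * y j.
    by rewrite mulr_sumr; apply: eq_bigr => j _; ring.
  rewrite Lx mulrBr mulr_sumr; congr (_ - _); first by ring.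
  by apply: eq_bigr => j _; ring.
have Lsq (x : I -> K) : \sum_i \sum_j L i j * x i * x j =
    2^-1 * \sum_i \sum_j a i j * (x i - x j) ^+ 2.
  by rewrite Lxx -laplacian_form //; congr (_ - _); apply: eq_bigr => i _; rewrite -mulrA.
have term0 (x : I -> K) i j : 0 <= a i j * (x i - x j) ^+ 2.
  have [->|ij] := eqVneq i j; first by rewrite subrr expr0n mulr0.
  by rewrite mulr_ge0 ?sqr_ge0 ?a_ge0.
have Lpos (x : I -> K) : 0 <= \sum_i \sum_j L i j * x i * x j.
  rewrite Lsq mulr_ge0 ?invr_ge0 //.
  by apply: sumr_ge0 => i _; apply: sumr_ge0.
have r0 i : 0 <= r i.
  by case: (r_pos i) => [/ltW //|a0]; rewrite /r big1.
(* A kernel vector of [L] has zero Dirichlet form, hence is constant where [r] is positive, and [u]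
   is [r]-orthogonal to constants. *)
have [v Lv] : exists v, forall i, \sum_j L i j * v j = r i * u i.
  apply: symmetric_solve => // z Lz.
  have zc i j : i != j -> 0 < a i j -> z i = z j.
    move=> ij aij.
    have : \sum_i \sum_j L i j * z i * z j = 0.
      apply: big1 => k _.
      by rewrite -[RHS](mulr0 (z k)) -[in RHS](Lz k) mulr_sumr; apply: eq_bigr => l _; ring.
    rewrite Lsq => /eqP; rewrite mulf_eq0 invr_eq0 pnatr_eq0 /=.
    rewrite psumr_eq0 => [|k _]; last exact: sumr_ge0.
    move=> /allP/(_ i); rewrite mem_index_enum => /(_ isT).
    rewrite psumr_eq0 // => /allP/(_ j); rewrite mem_index_enum => /(_ isT) /=.
    by rewrite mulf_eq0 gt_eqF //= sqrf_eq0 subr_eq0 => /eqP.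
  have {}zc := conn z zc.
  have [/existsP[k rk]|] := boolP [exists k, 0 < r k].
    transitivity (z k * \sum_i r i * u i); last by rewrite ru0 mulr0.
    rewrite mulr_sumr; apply: eq_bigr => i _.
    case: (r_pos i) => [ri|a0]; first by rewrite (zc i k) // mulrC.
    by rewrite /r big1 // !mul0r mulr0.
  move/existsPn => rk; apply: big1 => i _.
  by case: (r_pos i) => [ri|a0]; [have := rk i; rewrite ri | rewrite /r big1 // !mul0r].
set n2 := \sum_i r i * u i ^+ 2.
have n2E : n2 = \sum_i \sum_j L i j * u i * v j.
  apply: eq_bigr => i _; rewrite expr2 mulrA mulrC -Lv mulr_sumr.
  by apply: eq_bigr => j _; ring.
(* The hypothesis at [v] says that its energy is at most the [1/r]-weighted square norm of [L v],
   which is [n2] because [L v = r u]. *)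
have vv : \sum_i \sum_j L i j * v i * v j <= n2.
  have Hv := H v.
  have E : \sum_i (\sum_j L i j * v j) ^+ 2 / r i =
     \sum_i r i * v i * v i - 2 * (\sum_i \sum_j a i j * v i * v j)
       + \sum_i (\sum_j a i j * v j) ^+ 2 / r i.
    rewrite mulr_sumr -sumrB -big_split /=; apply: eq_bigr => i _; rewrite Lx.
    have -> : \sum_j a i j * v i * v j = v i * \sum_j a i j * v j.
      by rewrite mulr_sumr; apply: eq_bigr => j _; ring.
    case: (r_pos i) => [ri|a0]; first by field; rewrite gt_eqF.
    rewrite /r !big1 ?invr0 //; try by move=> j _; rewrite ?a0 ?mul0r.
    by ring.
  have -> : n2 = \sum_i (\sum_j L i j * v j) ^+ 2 / r i.
    apply: eq_bigr => i _; rewrite Lv.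
    case: (r_pos i) => [ri|a0]; first by field; rewrite gt_eqF.
    by rewrite /r big1 // invr0 mulr0 mul0r.
  rewrite E Lxx; lra.
(* This gives [n2^2 <= (u, L u) (v, L v) <= (u, L u) n2]. Hence [n2 <= (u, L u)], which is the claim
   since [L = diag(r) - a]. *)
have CS := psd_cauchy_schwarz u v LC Lpos.
rewrite -n2E in CS.
have n20 : 0 <= n2 by apply: sumr_ge0 => i _; rewrite mulr_ge0 ?sqr_ge0.
have uu := Lpos u.
have fin : n2 <= \sum_i \sum_j L i j * u i * u j.
  have [->//|n2n] := eqVneq n2 0.
  have n2p : 0 < n2 by rewrite lt_def n2n.
  rewrite -(ler_pM2r n2p) -expr2; apply: (le_trans CS).
  by rewrite ler_wpM2l.
have nE : n2 = \sum_i r i * u i * u i by apply: eq_bigr => i _; rewrite expr2 mulrA.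
rewrite Lxx -nE in fin; lra.
Qed.

End LocalGlobal.

(** The reverse Cauchy-Schwarz inequality in a plane: [Y], [X], [Z] stand for a form at (y, y), (y,
    z), (z, z). If it failed, the form would be positive definite there, yet it is nonpositive at
    the nonzero combination [s y - t z]. *)
Lemma negative_hyperplane (K : realFieldType) (Y X Z s t : K) :
  0 <= Y -> t != 0 -> s ^+ 2 * Y - 2 * s * t * X + t ^+ 2 * Z <= 0 ->
  Y * Z <= X ^+ 2.
Proof.
move=> Y0 t0 H; rewrite leNgt; apply/negP => XYZ.
have Yp : 0 < Y.
  by rewrite lt_def Y0 andbT; apply: contraL XYZ => /eqP ->; rewrite mul0r -leNgt sqr_ge0.
have tp : 0 < t ^+ 2 by rewrite lt_def sqrf_eq0 t0 sqr_ge0.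
have : 0 < (s * Y - t * X) ^+ 2 + t ^+ 2 * (Y * Z - X ^+ 2).
  by rewrite ltr_wpDl ?sqr_ge0 // mulr_gt0 // subr_gt0.
have -> : (s * Y - t * X) ^+ 2 + t ^+ 2 * (Y * Z - X ^+ 2) =
  Y * (s ^+ 2 * Y - 2 * s * t * X + t ^+ 2 * Z) by ring.
by rewrite pmulr_rgt0 // ltNge H.
Qed.

(** * Counting integer vectors in slices *)

Section Polarization.
Variables (V : finType) (side : V -> bool).
Local Notation vec := {ffun V -> nat}.
Implicit Types (J : seq vec) (P : {set V}) (k : {ffun bool -> nat}) (c : vec).

Definition lower (u : V) c : vec := [ffun v => (c v - (v == u))%N].

(** In the normalisation x^c / c! the derivative in x_u has coefficient 1 on every surviving
    monomial, so a plain list of exponents records it. *)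
Definition contract (u : V) J : seq vec := [seq lower u c | c <- J & (0 < c u)%N].

Definition raise k (b : bool) : {ffun bool -> nat} := [ffun b' => (k b' + (b' == b))%N].

Definition shifted_sum P (b : bool) c : nat := (\sum_(v in P | side v == b) (c v).+1)%N.

(* The exponent of the simplex parameter of side b is c(P_b) + |P_b| - 1; the shift by one
   avoids the truncated subtraction. *)
Definition fits P k c : bool :=
  [forall v, (v \notin P) ==> (c v == 0%N)] &&
  [forall b, shifted_sum P b c == (k b).+1].

(* The derivative, along the vectors of ws and [k b] times along the simplex of each side b, of
   the Dirichlet integral of the sum of x^c / c! over the vectors c in J. *)
Fixpoint polar (R : nzRingType) (ws : seq {ffun V + bool -> R}) J P k : R :=
  if ws is w :: ws' then
    \sum_u w (inl u) * polar ws' (contract u J) P k +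
    \sum_b w (inr b) * polar ws' J P (raise k b)
  else (count (fits P k) J)%:R.

Lemma contractC u v J : contract u (contract v J) = contract v (contract u J).
Proof.
rewrite /contract !filter_map -!map_comp -!filter_predI.
have -> : [seq c <- J | predI (preim (lower v) (fun c => 0 < c u)%N) (fun c => 0 < c v)%N c] =
  [seq c <- J | predI (preim (lower u) (fun c => 0 < c v)%N) (fun c => 0 < c u)%N c].
  apply: eq_filter => c /=; rewrite !ffunE eq_sym.
  by have [->|] := eqVneq v u; lia.
by apply: eq_map => c /=; apply/ffunP => w; rewrite !ffunE subnAC.
Qed.

Lemma raiseC k b b' : raise (raise k b) b' = raise (raise k b') b.
Proof. by apply/ffunP => x; rewrite !ffunE addnAC. Qed.

Lemma shifted_sum_rm P b c v : v \in P ->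
  shifted_sum P b c = ((side v == b) * (c v).+1 + shifted_sum (P :\ v) b c)%N.
Proof.
move=> vP; rewrite /shifted_sum; case: (boolP (side v == b)) => vb.
  rewrite (bigD1 v) ?vP //= mul1n; congr addn; apply: eq_bigl => u.
  by rewrite !inE andbC andbA.
rewrite mul0n; apply: eq_bigl => u; rewrite !inE.
by have [->|//] := eqVneq u v; rewrite (negPf vb) andbF.
Qed.

Lemma shifted_sum_lower P b c v : v \in P -> (0 < c v)%N ->
  shifted_sum P b c = ((b == side v) + shifted_sum P b (lower v c))%N.
Proof.
move=> vP cv; rewrite !(shifted_sum_rm _ _ vP) ffunE eqxx eq_sym.
have -> : shifted_sum (P :\ v) b (lower v c) = shifted_sum (P :\ v) b c.
  by apply: eq_bigr => u /andP[/setD1P[/negPf uv _] _]; rewrite ffunE uv subn0.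
by case: eqP => _; lia.
Qed.

(** Integration by parts on a simplex, one monomial at a time. If [c v] is 0, deleting [v] from [P]
    lowers the shifted sum by one; otherwise lowering [c v] does. The two cases exclude each other,
    whence the sum of booleans. *)
Lemma fits_rm P k v c : v \in P ->
  fits P (raise k (side v)) c =
    (fits (P :\ v) k c + (fits P k (lower v c) && (0 < c v)%N))%N :> nat.
Proof.
move=> vP; have [cv0|cv0] := posnP (c v).
  rewrite andbF addn0; congr (nat_of_bool (_ && _)).
    apply: eq_forallb => u; rewrite !inE negb_and negbK.
    by have [->|//] := eqVneq u v; rewrite vP cv0 eqxx.
  apply: eq_forallb => b; rewrite (shifted_sum_rm _ _ vP) cv0 ffunE.
  rewrite (eq_sym b); move: (side v == b) (shifted_sum _ _ _) => x y.
  by apply/eqP/eqP; case: x; lia.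
rewrite [fits (P :\ v) _ _](_ : _ = false) ?add0n ?andbT; last first.
  by apply/negP => /andP[/forallP/(_ v)]; rewrite !inE eqxx /= -leqn0 leqNgt cv0.
congr (nat_of_bool (_ && _)).
  apply: eq_forallb => u; rewrite ffunE.
  by have [->|uv] := eqVneq u v; rewrite ?vP ?subn0.
apply: eq_forallb => b; rewrite (shifted_sum_lower _ vP cv0) ffunE.
by apply/eqP/eqP; lia.
Qed.

Lemma count_split (T : Type) (a b d : pred T) (s : seq T) :
  (forall x, a x = (b x + d x)%N :> nat) -> count a s = (count b s + count d s)%N.
Proof. by move=> abd; elim: s => //= x s ->; rewrite abd addnACA. Qed.

Section Ring.
Variable R : comNzRingType.
Implicit Types (w : {ffun V + bool -> R}) (ws : seq {ffun V + bool -> R}).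

Lemma polar_swap w1 w2 ws J P k :
  polar (w1 :: w2 :: ws) J P k = polar (w2 :: w1 :: ws) J P k.
Proof.
rewrite /=.
under eq_bigr do rewrite mulrDr !mulr_sumr.
under [X in _ + X]eq_bigr do rewrite mulrDr !mulr_sumr.
under [X in _ = X + _]eq_bigr do rewrite mulrDr !mulr_sumr.
under [X in _ = _ + X]eq_bigr do rewrite mulrDr !mulr_sumr.
rewrite !big_split /= [RHS]addrACA.
congr ((_ + _) + (_ + _)); rewrite exchange_big; apply: eq_bigr => u _;
  apply: eq_bigr => v _; rewrite mulrCA //; first by rewrite contractC.
by rewrite raiseC.
Qed.

Lemma polar_congr w ws ws' J P k :
  (forall J' P' k', polar ws J' P' k' = polar ws' J' P' k') ->
  polar (w :: ws) J P k = polar (w :: ws') J P k.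
Proof. by move=> E /=; congr (_ + _); apply: eq_bigr => u _; rewrite E. Qed.

Lemma polar_rm v ws J P k : v \in P ->
  polar ws J P (raise k (side v)) = polar ws J (P :\ v) k + polar ws (contract v J) P k.
Proof.
move=> vP; elim: ws J k => [|w ws IH] J k /=.
  rewrite -natrD; congr _%:R; rewrite /contract count_map count_filter.
  by apply: count_split => c; exact: fits_rm.
under eq_bigr do rewrite IH mulrDr.
under [X in _ + X]eq_bigr do rewrite raiseC IH mulrDr.
rewrite !big_split /= addrACA; congr (_ + (_ + _)).
by apply: eq_bigr => u _; rewrite contractC.
Qed.

Lemma polar_lin (I : finType) (a : I -> R) (d : I -> {ffun V + bool -> R}) ws J P k :
  polar ([ffun l => \sum_i a i * d i l] :: ws) J P k = \sum_i a i * polar (d i :: ws) J P k.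
Proof.
rewrite /=.
under [X in _ = X]eq_bigr do rewrite mulrDr !mulr_sumr.
rewrite big_split /=; congr (_ + _); rewrite exchange_big; apply: eq_bigr => u _;
 by rewrite ffunE mulr_suml; apply: eq_bigr => i _; rewrite mulrA.
Qed.

Lemma polar_lin2 a1 a2 w1 w2 ws J P k :
  polar ([ffun l => a1 * w1 l + a2 * w2 l] :: ws) J P k =
  a1 * polar (w1 :: ws) J P k + a2 * polar (w2 :: ws) J P k.
Proof.
have := polar_lin (fun b => if b then a1 else a2) (fun b => if b then w1 else w2) ws J P k.
rewrite big_bool => <-; congr (polar (_ :: _) _ _ _).
by apply/ffunP => l; rewrite !ffunE big_bool.
Qed.

End Ring.
End Polarization.

(** * Signs of the derivatives, and the contraction and facet directions *)

Section Directions.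
Variables (V : finType) (side : V -> bool) (K : realFieldType).
Local Notation vec := {ffun V -> nat}.
Local Notation wvec := {ffun V + bool -> K}.
Local Notation polar := (polar side).
Implicit Types (J : seq vec) (P : {set V}) (k : {ffun bool -> nat}) (c : vec) (w : wvec)
  (ws : seq wvec).

Definition side_card P b : nat := #|[set v in P | side v == b]|.

Lemma side_card_rm P v b : v \in P ->
  side_card P b = ((side v == b) + side_card (P :\ v) b)%N.
Proof.
move=> vP; rewrite /side_card (cardsD1 v) !inE vP /=; congr (_ + _)%N.
by apply: eq_card => u; rewrite !inE; case: (u == v).
Qed.

Lemma side_card_shifted_sum P b c : (side_card P b <= shifted_sum side P b c)%N.
Proof. by rewrite /side_card -sum1dep_card leq_sum. Qed.

Lemma polar_nil ws P k : polar ws [::] P k = 0.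
Proof.
elim: ws k => //= w ws IH k.
by rewrite !big1 ?addr0 // => u _; rewrite IH mulr0.
Qed.

Lemma polar_no_side b ws J P k : side_card P b = 0%N -> polar ws J P k = 0.
Proof.
move=> P0; elim: ws J k => [|w ws IH] J k /=.
  rewrite (_ : count _ _ = 0%N) //; apply/eqP; rewrite -leqn0 leqNgt -has_count.
  apply/hasPn => c _; apply/negP => /andP[_ /forallP/(_ b)].
  rewrite /shifted_sum big_pred0 // => v; apply/negbTE/negP => vP.
  by move/eqP: P0; rewrite cards_eq0 => /eqP/setP/(_ v); rewrite !inE vP.
by rewrite !big1 ?addr0 // => u _; rewrite IH mulr0.
Qed.

(** The integral vanishes to order [side_card P b - 1] in the parameter of side [b], since every
    point of the side adds at least 1 to the shifted sum. Directions without a component along [b]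
    cannot raise the level that far. *)
Lemma polar_low_level b ws J P k :
  (forall w, w \in ws -> w (inr b) = 0) -> ((k b).+1 < side_card P b)%N ->
  polar ws J P k = 0.
Proof.
elim: ws J k => [|w ws IH] J k w0 kb /=.
  rewrite (_ : count _ _ = 0%N) //; apply/eqP; rewrite -leqn0 leqNgt -has_count.
  apply/hasPn => c _; apply/negP => /andP[_ /forallP/(_ b)/eqP] E.
  by have := side_card_shifted_sum P b c; rewrite E leqNgt kb.
have ws0 w' : w' \in ws -> w' (inr b) = 0 by move=> ?; apply: w0; rewrite inE orbC ; apply/orP;
  left.
rewrite !big1 ?addr0 // => [b' _|u _]; last by rewrite IH ?mulr0.
have [->|bb] := eqVneq b' b; first by rewrite w0 ?mem_head // mul0r.
by rewrite IH ?mulr0 // ffunE (eq_sym b) (negPf bb) addn0.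
Qed.

Lemma polar_ge0 ws J P k : (forall w, w \in ws -> forall l, 0 <= w l) -> 0 <= polar ws J P k.
Proof.
elim: ws J k => [|w ws IH] J k w0 /=; first exact: ler0n.
have ws0 w' : w' \in ws -> forall l, 0 <= w' l by move=> ?; apply: w0; rewrite inE orbC ;
  apply/orP; left.
by rewrite addr_ge0 // sumr_ge0 // => u _; rewrite mulr_ge0 ?IH // w0 ?mem_head.
Qed.

Lemma mem_contract u J c : (c \in contract u J) = ([ffun v => (c v + (v == u))%N] \in J).
Proof.
apply/mapP/idP => [[c' + ->]|cJ].
  rewrite mem_filter => /andP[c'u c'J].
  rewrite (_ : [ffun v => _] = c') //; apply/ffunP => v; rewrite !ffunE.
  by have [->|_] := eqVneq v u; rewrite ?subnK ?subn0 ?addn0.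
exists [ffun v => (c v + (v == u))%N].
  by rewrite mem_filter cJ ffunE eqxx addn1.
by apply/ffunP => v; rewrite !ffunE addnK.
Qed.

Lemma lower_sum u c : (0 < c u)%N -> (\sum_v lower u c v = (\sum_v c v).-1)%N.
Proof.
move=> cu; rewrite (bigD1 u) //= [in RHS](bigD1 u) //= ffunE eqxx.
rewrite (eq_bigr (fun v => c v)) => [|v /negPf vu]; last by rewrite ffunE vu subn0.
by case: (c u) cu => // n _; rewrite subSS subn0.
Qed.

Lemma lower_mem u c J : c \in J -> (0 < c u)%N -> lower u c \in contract u J.
Proof. by move=> cJ cu; apply/mapP; exists c; rewrite // mem_filter cu. Qed.

(** All terms are nonnegative, so one nonzero chain of choices suffices: directions are spent on
    lowering [c] to 0 and on raising each level to [side_card P b - 1], where the zero vector fits.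
    The last hypothesis says that their number is exactly right. *)
Lemma polar_gt0 ws J P k c :
  (forall w, w \in ws -> forall l, 0 < w l) -> c \in J ->
  (forall b, (k b).+1 <= side_card P b)%N ->
  (\sum_v c v + \sum_b (side_card P b - (k b).+1) = size ws)%N ->
  0 < polar ws J P k.
Proof.
elim: ws J k c => [|w ws IH] J k c w0 cJ kP /eqP /=.
  rewrite addn_eq0 !sum_nat_eq0 => /andP[/forallP c0 /forallP k0].
  rewrite ltr0n -has_count; apply/hasP; exists c => //.
  apply/andP; split; first by apply/forallP => v; have /= -> := c0 v; rewrite implybT.
  apply/forallP => b; apply/eqP; rewrite -[RHS](_ : side_card P b = _); last first.
    by have := kP b; have /= /eqP := k0 b; lia.
  rewrite /side_card -sum1dep_card; apply: eq_bigr => v _.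
  by have /= /eqP-> := c0 v.
move=> sz.
have ws0 w' : w' \in ws -> forall l, 0 < w' l by move=> ?; apply: w0; rewrite inE orbC ;
  apply/orP; left.
have wsge w' : w' \in ws -> forall l, 0 <= w' l by move=> ? ?; rewrite ltW ?ws0.
have wl l : 0 < w l by apply: w0; rewrite mem_head.
have t1 u : 0 <= w (inl u) * polar ws (contract u J) P k.
  by apply: mulr_ge0; [exact: ltW | exact: polar_ge0].
have t2 b : 0 <= w (inr b) * polar ws J P (raise k b).
  by apply: mulr_ge0; [exact: ltW | exact: polar_ge0].
have [/existsP[u cu]|/existsPn cn] := boolP [exists u, (0 < c u)%N].
  apply: ltr_pwDl; last exact: sumr_ge0.
  rewrite (bigD1 u) //=; apply: ltr_pwDl; last exact: sumr_ge0.
  rewrite mulr_gt0 // (IH _ _ (lower u c)) // ?lower_mem // lower_sum //.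
  have : (0 < \sum_v c v)%N by rewrite (bigD1 u) //= addn_gt0 cu.
  by case: (\sum_v c v)%N sz => // n; rewrite addSn eqSS => /eqP.
have c0 : (\sum_v c v = 0)%N by apply: big1 => v _; apply/eqP; rewrite -leqn0 leqNgt cn.
have [/existsP[b kb]|/existsPn kn] := boolP [exists b, ((k b).+1 < side_card P b)%N].
  rewrite addrC; apply: ltr_pwDl; last exact: sumr_ge0.
  rewrite (bigD1 b) //=; apply: ltr_pwDl; last exact: sumr_ge0.
  rewrite mulr_gt0 // (IH _ _ c) // ?c0 => [b'|].
    by rewrite ffunE; have := kP b'; case: eqP => [->|]; lia.
  move: sz; rewrite c0 !(bigD1 b (P := xpredT)) //= ffunE eqxx.
  under [X in (_ + (_ + X))%N = _]eq_bigr => b' /negPf bb' do rewrite ffunE bb' addn0.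
  by move=> /eqP; lia.
exfalso; move: sz; rewrite c0 big1 // => b _.
by apply/eqP; rewrite subn_eq0 leqNgt kn.
Qed.

(** [inl u] is the derivative in x_u. [inr v] is the direction [side - x_v], which restricts to the
    facet without [v]; it is 0 for [v] outside [P]. *)
Definition dir P (i : V + V) : wvec :=
  match i with
  | inl u => [ffun l => (l == inl u)%:R]
  | inr v => [ffun l => if v \in P then (l == inr (side v))%:R - (l == inl v)%:R else 0]
  end.

(** The directions [dir P i] are in general dependent. Spreading the weight of a side evenly over
    its points is the choice that keeps the coordinates of a positive [w] positive, except at
    [inr v] with [v] outside [P]. *)
Definition dir_coord P w (i : V + V) : K :=
  match i with
  | inl u => w (inl u) + (u \in P)%:R * (w (inr (side u)) / (side_card P (side u))%:R)
  | inr v => (v \in P)%:R * (w (inr (side v)) / (side_card P (side v))%:R)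
  end.

Lemma polar_dirl P' u ws J P k : polar (dir P' (inl u) :: ws) J P k = polar ws (contract u J) P k.
Proof.
rewrite /= (bigD1 u) //= !big1 => [|b _|v /negPf vu]; rewrite !ffunE /= ?mul0r //.
  by rewrite eqxx mul1r !addr0.
by rewrite (_ : (inl v == inl u) = false) ?mul0r.
Qed.

Lemma polar_dirr v ws J P k : v \in P ->
  polar (dir P (inr v) :: ws) J P k = polar ws J (P :\ v) k.
Proof.
move=> vP /=; rewrite (bigD1 v) //= [X in _ + X](bigD1 (side v)) //=.
rewrite !big1 => [|b /negPf bv|u /negPf uv]; rewrite !ffunE vP /=.
- by rewrite !eqxx (polar_rm _ _ _ _ vP) /=; ring.
- by rewrite (_ : (inr b == inr (side v)) = false) ?subr0 ?mul0r.
- by rewrite (_ : (inl u == inl v) = false) ?subr0 ?mul0r.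
Qed.

Lemma polar_dir_out v ws J P k : v \notin P -> polar (dir P (inr v) :: ws) J P k = 0.
Proof.
move=> /negPf vP /=; rewrite !big1 ?addr0 // => u _; by rewrite ffunE vP mul0r.
Qed.

(* Each [raise] direction is the average over its side of the directions of
   [polar_dirr] and [polar_dirl]. *)
Lemma polar_expand w ws J P k : (forall b, 0 < side_card P b)%N ->
  polar (w :: ws) J P k = \sum_i dir_coord P w i * polar (dir P i :: ws) J P k.
Proof.
move=> P0; rewrite big_sumType.
under eq_bigr do rewrite polar_dirl /dir_coord mulrDl.
rewrite big_split /= -addrA; congr (_ + _).
have -> : \sum_v (v \in P)%:R * (w (inr (side v)) / (side_card P (side v))%:R) *
     polar (dir P (inr v) :: ws) J P k =
   \sum_(v in P) (w (inr (side v)) / (side_card P (side v))%:R) * polar ws J (P :\ v) k.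
  rewrite [RHS]big_mkcond; apply: eq_bigr => v _.
  case: ifP => vP; first by rewrite mul1r polar_dirr.
  by rewrite !mul0r.
have -> : \sum_v (v \in P)%:R * (w (inr (side v)) / (side_card P (side v))%:R) *
     polar ws (contract v J) P k =
   \sum_(v in P) (w (inr (side v)) / (side_card P (side v))%:R) * polar ws (contract v J) P k.
  rewrite [RHS]big_mkcond; apply: eq_bigr => v _.
  by case: ifP => vP; rewrite ?mul1r // !mul0r.
rewrite addrC -big_split /= (partition_big side xpredT) //=; apply: eq_bigr => b _.
transitivity (\sum_(v in P | side v == b) w (inr b) / (side_card P b)%:R * polar ws J P (raise k
  b)).
  rewrite sumr_const (_ : #|_| = side_card P b); last first.
    by apply: eq_card => v; rewrite !inE.
  by rewrite -mulr_natr; field; rewrite pnatr_eq0 -lt0n.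
apply: eq_bigr => v /andP[vP /eqP vb].
by rewrite -mulrDr -(polar_rm side ws J k vP) vb.
Qed.

End Directions.

(** * M-convex sets and hyperbolicity *)

Section MConvex.
Variable V : finType.
Local Notation vec := {ffun V -> nat}.
Implicit Types (J : seq vec) (c q : vec).

(** The one-sided exchange axiom: only [q] moves, one unit towards [q'], as for bases of a
    matroid. *)
Definition exchangeable J := forall q q' u, q \in J -> q' \in J -> (q' u < q u)%N ->
  exists2 v, (q v < q' v)%N & [ffun x => (q x - (x == u) + (x == v))%N] \in J.

Definition m_convex d J :=
  [/\ uniq J, forall c, c \in J -> (\sum_v c v = d)%N & exchangeable J].

Lemma contract_m_convex d u J : m_convex d J -> m_convex d.-1 (contract u J).
Proof.
move=> [uJ sJ eJ]; split.
- have inj (c c' : vec) : (0 < c u)%N -> (0 < c' u)%N -> lower u c = lower u c' -> c = c'.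
    move=> cu cu' /ffunP E; apply/ffunP => v.
    by have := E v; rewrite !ffunE; have [->|_] := eqVneq v u; lia.
  rewrite map_inj_in_uniq ?filter_uniq // => c c'; rewrite !mem_filter.
  by move=> /andP[cu _] /andP[cu' _]; exact: inj.
- move=> c /mapP[c']; rewrite mem_filter => /andP[cu /sJ <-] ->.
  exact: lower_sum.
move=> q q' w; rewrite !mem_contract => qJ qJ' qw.
have [|v qv E] := eJ _ _ w qJ qJ'; first by rewrite !ffunE ltn_add2r.
exists v; first by move: qv; rewrite !ffunE ltn_add2r.
rewrite mem_contract; congr (_ \in J): E; apply/ffunP => x; rewrite !ffunE.
by have [->|xw] := eqVneq x w; lia.
Qed.

Lemma contract2_neq_nil J c u v : c \in J -> u != v -> (0 < c u)%N -> (0 < c v)%N ->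
  contract v (contract u J) != [::].
Proof.
move=> cJ uv cu cv; have : lower v (lower u c) \in contract v (contract u J).
  by rewrite !lower_mem // ffunE eq_sym (negPf uv) subn0.
by case: (contract v _).
Qed.

Lemma contract_neq_nilP J u : contract u J != [::] -> exists2 c, c \in J & (0 < c u)%N.
Proof.
case E : (contract u J) => [//|c s] _.
have : c \in contract u J by rewrite E mem_head.
by case/mapP => c'; rewrite mem_filter => /andP[? ?] _; exists c'.
Qed.

Lemma exists_pos c : (0 < \sum_v c v)%N -> exists v, (0 < c v)%N.
Proof.
move=> c0; have [/existsP //|/existsPn cn] := boolP [exists v, (0 < c v)%N].
move: c0; rewrite big1 // => v _; apply/eqP; by rewrite -leqn0 leqNgt cn.
Qed.

(** Take [c] positive at [u], [c'] positive at [v], and a further unit of [c] at [w]. If [c'] has at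
    least as much at [w], then [w] is a common neighbour. Otherwise exchange moves that unit of [c]
    to some [x] where [c'] is positive, keeping [u], and [x] is one. *)
Lemma m_convex_connected d J u v : m_convex d J -> (1 < d)%N ->
  contract u J != [::] -> contract v J != [::] ->
  exists x, (u = x \/ u != x /\ contract x (contract u J) != [::]) /\
            (x = v \/ x != v /\ contract v (contract x J) != [::]).
Proof.
move=> [_ sJ eJ] d1 /contract_neq_nilP[c cJ cu] /contract_neq_nilP[c' cJ' cv].
have adj c0 x y : c0 \in J -> (0 < c0 x)%N -> (0 < c0 y)%N ->
    x = y \/ x != y /\ contract y (contract x J) != [::].
  move=> c0J xp yp; have [->|xy] := eqVneq x y; first by left.
  by right; split=> //; exact: contract2_neq_nil xp yp.
have [|w] := @exists_pos (lower u c); first by rewrite lower_sum ?sJ //; lia.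
rewrite ffunE => cw.
have cw0 : (0 < c w)%N := leq_trans cw (leq_subr _ _).
have [le|lt] := leqP (c w) (c' w).
  exists w; split; first exact: adj cu cw0.
  by apply: adj cJ' _ cv; exact: leq_trans le.
have [x cx xJ] := eJ _ _ _ cJ cJ' lt.
exists x; split; last by apply: adj cJ' _ cv; exact: leq_ltn_trans cx.
apply: adj xJ _ _; rewrite ffunE ?eqxx ?addn1 //.
rewrite addn_gt0; apply/orP; left.
by have [uw|uw] := eqVneq u w; rewrite ?subn0 // uw; move: cw; rewrite uw eqxx.
Qed.

(** For [J] of degree 2 this is the entry of the Hessian of the generating polynomial, as 0 is then
    the only vector a double contraction can contain. *)
Definition pair_in J u v := [ffun=> 0%N] \in contract v (contract u J).

Lemma pair_inC J u v : pair_in J u v = pair_in J v u.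
Proof. by rewrite /pair_in contractC. Qed.

Lemma pair_inE J u v : pair_in J u v = ([ffun x => ((x == u) + (x == v))%N] \in J).
Proof.
rewrite /pair_in !mem_contract; apply: (congr1 (fun q => q \in J)); apply/ffunP => x.
by rewrite !ffunE add0n addnC.
Qed.

Lemma pair_in_contract J u v : pair_in J u v -> contract u J != [::].
Proof. by rewrite /pair_in; case: (contract u J). Qed.

Lemma contract_pair_in J u : m_convex 2 J -> contract u J != [::] -> exists x, pair_in J u x.
Proof.
move=> mJ uJ; have [_ s1 _] := contract_m_convex u mJ.
case E : (contract u J) uJ => [//|c s] _.
have cJ : c \in contract u J by rewrite E mem_head.
have [|x cx] := @exists_pos c; first by rewrite s1.
exists x; have [_ s0 _] := contract_m_convex x (contract_m_convex u mJ).
have xJ := lower_mem cJ cx.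
rewrite /pair_in (_ : [ffun=> 0%N] = lower x c) //.
apply/ffunP => y; rewrite [LHS]ffunE; apply/esym/eqP.
by have /eqP := s0 _ xJ; rewrite sum_nat_eq0 => /forallP/(_ y).
Qed.

(** Contrapositively, not forming a pair is transitive on the elements that occur in [J]. Some pair
    [v], [x] lies in [J]; if [x] is neither [u] nor [w], exchanging [x] against the pair [u], [w]
    replaces it by one of them. *)
Lemma pair_in_trans J u v w : m_convex 2 J -> pair_in J u w -> contract v J != [::] ->
  pair_in J v u || pair_in J v w.
Proof.
move=> mJ uw /(contract_pair_in mJ)[x vx].
have [-> //|xu] := eqVneq u x; first by rewrite vx.
have [<-|xw] := eqVneq x w; first by rewrite vx orbT.
have [_ _ eJ] := mJ.
rewrite !pair_inE in vx uw.
have [|y] := eJ _ _ x vx uw.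
  by rewrite !ffunE (eq_sym x u) (negPf xu) (negPf xw) eqxx addn1.
rewrite !ffunE => ylt E.
have {}E : pair_in J v y.
  rewrite pair_inE; congr (_ \in J): E; apply/ffunP => z; rewrite !ffunE.
  by rewrite addnK.
have [yu|yu] := eqVneq y u; first by rewrite -yu E.
have [yw|yw] := eqVneq y w; first by rewrite -yw E orbT.
by rewrite (negPf yu) (negPf yw) in ylt.
Qed.

End MConvex.

(** A partial equivalence relation is a direct sum of all-ones blocks, each giving a square. To
    avoid representatives, the square of a class is counted once for each member [w], with weight
    the inverse of the class size. *)
Lemma per_form_ge0 (K : realFieldType) (V : finType) (n : rel V) (x : V -> K) :
  symmetric n -> transitive n -> 0 <= \sum_u \sum_v (n u v)%:R * x u * x v.
Proof.
move=> nC nT.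
pose s w := #|[set x | n w x]|.
suff -> : \sum_u \sum_v (n u v)%:R * x u * x v =
    \sum_w ((s w)%:R)^-1 * (\sum_u (n w u)%:R * x u) ^+ 2.
  by apply: sumr_ge0 => w _; rewrite mulr_ge0 ?sqr_ge0 ?invr_ge0 ?ler0n.
under [RHS]eq_bigr do rewrite expr2 mulr_suml mulr_sumr.
rewrite [RHS]exchange_big; apply: eq_bigr => u _ /=.
under [RHS]eq_bigr do rewrite !mulr_sumr.
rewrite [RHS]exchange_big; apply: eq_bigr => v _ /=.
transitivity (\sum_w (s w)%:R^-1 * (n w u)%:R * (n w v)%:R * (x u * x v)); last first.
  by apply: eq_bigr => w _; ring.
rewrite -mulr_suml -mulrA; congr (_ * _).
case nuv : (n u v); last first.
  rewrite big1 // => w _; case nwu : (n w u); last by rewrite mulr0 mul0r.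
  case nwv : (n w v); last by rewrite mulr0.
  by rewrite (nT _ _ _ _ nwv) // nC in nuv.
transitivity (\sum_(w in [set w | n u w]) (s u)%:R^-1 : K).
  rewrite sumr_const -/(s u) -[RHS]mulr_natr mulVf // pnatr_eq0 -lt0n.
  by apply/card_gt0P; exists v; rewrite inE.
rewrite [LHS]big_mkcond; apply: eq_bigr => w _; rewrite inE nC.
case nwu : (n w u); last by rewrite mulr0 mul0r.
rewrite (nT _ _ _ nwu nuv) !mulr1; congr (_%:R^-1); apply: eq_card => y; rewrite !inE.
apply/idP/idP; first exact: nT.
by apply: nT; rewrite nC.
Qed.

Section Hyperbolic.
Variables (V : finType) (side : V -> bool) (K : realFieldType).
Local Notation vec := {ffun V -> nat}.
Local Notation wvec := {ffun V + bool -> K}.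
Local Notation level0 := ([ffun=> 0%N] : {ffun bool -> nat}).
Local Notation polar := (polar side).
Local Notation side_card := (side_card side).
Local Notation dir := (dir side K).
Local Notation dir_coord := (dir_coord side).
Implicit Types (J : seq vec) (P : {set V}) (k : {ffun bool -> nat}) (c : vec) (w : wvec)
  (ws : seq wvec).

Lemma polar_combination s t (y z : wvec) ws J P k :
  let x := [ffun l => s * y l + t * z l] in
  polar (x :: x :: ws) J P k = s ^+ 2 * polar (y :: y :: ws) J P k
    + 2 * s * t * polar (y :: z :: ws) J P k + t ^+ 2 * polar (z :: z :: ws) J P k.
Proof.
move=> x; rewrite polar_lin2 !(polar_swap _ _ x) !polar_lin2 (polar_swap _ z y); ring.
Qed.

Lemma polar_one_point z ws J P k : (forall b, side_card P b = 1%N) ->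
  polar (z :: ws) J P k = \sum_u dir_coord P z (inl u) * polar ws (contract u J) P k.
Proof.
move=> P1; rewrite polar_expand => [|b]; last by rewrite P1.
rewrite big_sumType -[RHS]addr0; congr (_ + _).
  by apply: eq_bigr => u _; rewrite polar_dirl.
apply: big1 => v _.
have [vP|vP] := boolP (v \in P); last by rewrite polar_dir_out ?mulr0.
rewrite polar_dirr // (polar_no_side (b := side v)) ?mulr0 //.
by have := side_card_rm side (side v) vP; rewrite P1 eqxx; case.
Qed.

Lemma polar_pair J P u v : m_convex 2 J -> (forall b, side_card P b = 1%N) ->
  polar [::] (contract v (contract u J)) P level0 = (pair_in J u v)%:R :> K.
Proof.
move=> mJ P1 /=; rewrite /pair_in; congr _%:R.
have [uJ sJ _] := contract_m_convex v (contract_m_convex u mJ).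
rewrite -count_uniq_mem //; apply: eq_in_count => c /sJ /eqP.
rewrite sum_nat_eq0 => /forallP c0.
have -> : c = [ffun=> 0%N].
  by apply/ffunP => x; rewrite ffunE; apply/eqP/c0.
rewrite /= eqxx; apply/andP; split; first by apply/forallP => x; rewrite ffunE implybT.
apply/forallP => b; rewrite ffunE -[X in _ == X](P1 b) /side_card -sum1dep_card.
by apply/eqP; apply: eq_bigr => x _; rewrite ffunE.
Qed.

(** The integral is quadratic here. If a side has several points, the form is divisible by its
    parameter, so the combination of [y] and [z] without component there is isotropic. If both sides
    have one point, then [d] = 2 and, on the elements occurring in [J], the matrix is all-ones minus
    the partial equivalence [n]; the form is then nonpositive where the linear form [l] vanishes. *)
Lemma polar_hyperbolic0 J P d (y z : wvec) : m_convex d J ->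
  (d + side_card P false + side_card P true = 4)%N -> (forall l, 0 < y l) ->
  polar [:: y; y] J P level0 * polar [:: z; z] J P level0 <=
  polar [:: y; z] J P level0 ^+ 2.
Proof.
move=> mJ dP y0.
have yy0 : 0 <= polar [:: y; y] J P level0.
  by apply: polar_ge0 => w; rewrite !inE orbb => /eqP -> l; exact: ltW.
have [/existsP[b /eqP Pb]|/existsPn Pn] := boolP [exists b, side_card P b == 0%N].
  by rewrite !(polar_no_side (b := b)) // expr0n mulr0.
have [/existsP[b Pb]|/existsPn Pb] := boolP [exists b, (1 < side_card P b)%N].
  apply: (@negative_hyperplane _ _ _ _ (z (inr b)) (y (inr b))) => //.
    by rewrite gt_eqF.
  have := polar_combination (z (inr b)) (- y (inr b)) y z [::] J P level0.
  set w := finfun _ => E.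
  have w0 : polar [:: w; w] J P level0 = 0.
    apply: (polar_low_level (b := b)); last by rewrite ffunE.
    by move=> w'; rewrite !inE orbb => /eqP ->; rewrite ffunE; ring.
  by rewrite -[X in _ <= X]w0 [X in _ <= X]E le_eqVlt; apply/orP; left; apply/eqP; ring.
have P1 b : side_card P b = 1%N by have := Pn b; have := Pb b; case: (side_card P b) => [|[]].
have {dP} d2 : d = 2%N by move: dP; rewrite !P1; lia.
rewrite {d}d2 in mJ.
pose x (a : wvec) u := dir_coord P a (inl u).
have QE a b : polar [:: a; b] J P level0 = \sum_u \sum_v (pair_in J u v)%:R * x a u * x b v.
  rewrite polar_one_point //; apply: eq_bigr => u _.
  rewrite polar_one_point // mulr_sumr; apply: eq_bigr => v _.
  by rewrite polar_pair // /x; ring.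
pose U u := contract u J != [::].
pose l a := \sum_(u | U u) x a u.
have xy0 u : 0 < x y u.
  rewrite /x /= ltr_pwDl //.
  by rewrite !mulr_ge0 ?invr_ge0 ?ler0n // ltW.
have [/existsP[u0 u0P]|/existsPn nU] := boolP [exists u, U u]; last first.
  have Q0 (a b : wvec) : polar [:: a; b] J P level0 = 0.
    rewrite QE; apply: big1 => u _; apply: big1 => v _.
    case uv : (pair_in J u v); last by rewrite !mul0r.
    by have := nU u; rewrite /U (pair_in_contract uv).
  by rewrite !Q0 expr0n mulr0.
have ly0 : 0 < l y.
  by rewrite /l (bigD1 u0) //= ltr_pwDl //; apply: sumr_ge0 => u _; exact: ltW.
apply: (@negative_hyperplane _ _ _ _ (l z) (l y)) => //; first by rewrite gt_eqF.
have := polar_combination (l z) (- l y) y z [::] J P level0.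
set w := finfun _ => E.
have lw : l w = 0.
  have xw u : x w u = l z * x y u - l y * x z u by rewrite /x /= !ffunE; ring.
  rewrite /l (eq_bigr _ (fun u _ => xw u)) sumrB -!mulr_sumr -/(l y) -/(l z); ring.
suff : polar [:: w; w] J P level0 <= 0 by rewrite E; lra.
pose n u v := [&& U u, U v & ~~ pair_in J u v].
have nC : symmetric n by move=> u v; rewrite /n pair_inC andbCA.
have nT : transitive n.
  move=> v u t /and3P[uU vU uv] /and3P[_ tU vt]; apply/and3P; split=> //.
  apply/negP => ut; have := pair_in_trans mJ ut vU.
  by rewrite pair_inC (negPf uv) (negPf vt).
have := per_form_ge0 (x w) nC nT.
suff -> : polar [:: w; w] J P level0 = l w ^+ 2 - \sum_u \sum_v (n u v)%:R * x w u * x w v.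
  by rewrite lw expr0n sub0r oppr_le0.
have -> : l w = \sum_u (U u)%:R * x w u.
  by rewrite /l big_mkcond; apply: eq_bigr => u _; case: (U u); rewrite ?mul1r ?mul0r.
rewrite QE expr2 mulr_suml -sumrB; apply: eq_bigr => u _.
rewrite mulr_sumr -sumrB; apply: eq_bigr => v _.
rewrite /n; case uv : (pair_in J u v).
  have := uv; rewrite pair_inC => vu.
  by rewrite /U (pair_in_contract uv) (pair_in_contract vu) /=; ring.
by case: (U u); case: (U v) => /=; ring.
Qed.

End Hyperbolic.

(** * The inductive step for the Hodge-Riemann inequality *)

Section HyperbolicStep.
Variables (V : finType) (side : V -> bool) (K : realFieldType).
Local Notation vec := {ffun V -> nat}.
Local Notation wvec := {ffun V + bool -> K}.
Local Notation level0 := ([ffun=> 0%N] : {ffun bool -> nat}).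
Local Notation polar := (polar side).
Local Notation side_card := (side_card side).
Local Notation dir := (dir side K).
Local Notation dir_coord := (dir_coord side).
Implicit Types (J : seq vec) (P : {set V}) (k : {ffun bool -> nat}) (c : vec) (w : wvec)
  (ws : seq wvec).

(** The indices whose contraction or facet leaves a nonempty [J] and two nonempty sides, when both
    sides of [P] are nonempty; the other rows of the Hessian vanish. *)
Definition active J P (i : V + V) : bool :=
  match i with
  | inl u => contract u J != [::]
  | inr v => (v \in P) && (1 < side_card P (side v))%N
  end.

Lemma polar_inactive i ws J P k : ~~ active J P i -> polar (dir P i :: ws) J P k = 0.
Proof.
case: i => [u|v].
  by move=> /negPn/eqP uJ; rewrite polar_dirl uJ polar_nil.
rewrite negb_and => /orP[vP|cv]; first exact: polar_dir_out.
have [vP|vP] := boolP (v \in P); last exact: polar_dir_out.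
rewrite polar_dirr // (polar_no_side (b := side v)) //.
by have := side_card_rm side (side v) vP; rewrite eqxx; lia.
Qed.

(** The number of directions equals the degree [d + r1 + r2 - 2] of the integral, so the derivative
    is a constant, and any member of [J] makes it positive. *)
Lemma polar_state_gt0 d J P ws : m_convex d J -> J != [::] ->
  (forall b, 0 < side_card P b)%N ->
  (d + side_card P false + side_card P true = (size ws).+2)%N ->
  (forall w, w \in ws -> forall l, 0 < w l) -> 0 < polar ws J P level0.
Proof.
move=> [_ sJ _]; case: J sJ => // c J sJ _ P0 sz ws0.
apply: (@polar_gt0 _ _ _ _ _ _ _ c) => //; first exact: mem_head.
  by move=> b; rewrite ffunE.
rewrite sJ ?mem_head // big_bool !ffunE /=.
by have := P0 true; have := P0 false; lia.
Qed.

Lemma contract_degree_gt0 d u J : m_convex d J -> contract u J != [::] -> (0 < d)%N.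
Proof.
by move=> [_ sJ _] /contract_neq_nilP[c /sJ <- cu]; rewrite (bigD1 u) //= addn_gt0 cu.
Qed.

Lemma side_card_total_rm P v : v \in P ->
  (side_card P false + side_card P true =
   (side_card (P :\ v) false + side_card (P :\ v) true).+1)%N.
Proof. by move=> vP; rewrite !(side_card_rm _ _ vP); case: (side v) => /=; lia. Qed.

Lemma polar_dir_rr u v ws J P k : u \in P -> v \in P -> u != v ->
  polar (dir P (inr u) :: dir P (inr v) :: ws) J P k = polar ws J (P :\ u :\ v) k.
Proof.
move=> uP vP uv; rewrite polar_dirr //.
have vPu : v \in P :\ u by rewrite !inE eq_sym uv.
rewrite (_ : dir P (inr v) = dir (P :\ u) (inr v)) ?polar_dirr //.
by apply/ffunP => l; rewrite !ffunE vP vPu.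
Qed.

Section Step.
Variables (d : nat) (J : seq vec) (P : {set V}) (y0 : wvec) (ys : seq wvec).
Hypotheses (mJ : m_convex d J) (J0 : J != [::]) (P0 : forall b, (0 < side_card P b)%N).
Hypothesis sz : (d + side_card P false + side_card P true = size ys + 5)%N.
Hypothesis ys0 : forall w, w \in y0 :: ys -> forall l, 0 < w l.
Hypothesis IH : forall J' P' d' (z : wvec), m_convex d' J' ->
  (d' + side_card P' false + side_card P' true = size ys + 4)%N ->
  polar (y0 :: y0 :: ys) J' P' level0 * polar (z :: z :: ys) J' P' level0 <=
  polar (y0 :: z :: ys) J' P' level0 ^+ 2.

(** The Hessian along contractions and facets, with [y0 :: ys] frozen. An off-diagonal entry is 0 or
    an integral for a smaller [J] or [P], hence nonnegative. *)
Let A i j := polar (dir P i :: dir P j :: y0 :: ys) J P level0.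
Let c i := dir_coord P y0 i.

Let AC i j : A i j = A j i. Proof. exact: polar_swap. Qed.

Let rest_ge0 J' P' k : 0 <= polar (y0 :: ys) J' P' k.
Proof. by apply: polar_ge0 => w wy l; rewrite ltW ?ys0. Qed.

Let A_ge0 i j : i != j -> 0 <= A i j.
Proof.
case: i j => [u|u] [v|v] uv; rewrite /A.
- by rewrite !polar_dirl.
- have [vP|vP] := boolP (v \in P); first by rewrite polar_dirl polar_dirr.
  by rewrite polar_swap polar_dir_out.
- have [uP|uP] := boolP (u \in P); first by rewrite polar_swap polar_dirl polar_dirr.
  by rewrite polar_dir_out.
have [uP|uP] := boolP (u \in P); last by rewrite polar_dir_out.
have [vP|vP] := boolP (v \in P); last by rewrite polar_swap polar_dir_out.
by rewrite polar_dir_rr.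
Qed.

Let c_ge0 i : 0 <= c i.
Proof.
have y0p l : 0 <= y0 l by rewrite ltW ?ys0 ?mem_head.
by case: i => v; rewrite /c /=; rewrite ?addr_ge0 // mulr_ge0 ?divr_ge0 ?ler0n.
Qed.

Let c_gt0 i : active J P i -> 0 < c i.
Proof.
have y0p l : 0 < y0 l by rewrite ys0 ?mem_head.
case: i => [u _|v /andP[vP cv]]; rewrite /c /=.
  by rewrite ltr_pwDl // mulr_ge0 ?ler0n // divr_ge0 ?ler0n // ltW.
by rewrite vP mul1r divr_gt0 // ltr0n.
Qed.

Let r_gt0 i : active J P i -> 0 < polar (dir P i :: y0 :: y0 :: ys) J P level0.
Proof.
have pos w : w \in [:: y0, y0 & ys] -> forall l, 0 < w l.
  by rewrite inE => /orP[/eqP ->|]; apply: ys0; rewrite mem_head.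
case: i => [u uJ|v /andP[vP cv]].
  rewrite polar_dirl; apply: (polar_state_gt0 (contract_m_convex u mJ)) => //=.
  by have := contract_degree_gt0 mJ uJ; move: sz; clear; lia.
rewrite polar_dirr //; apply: (polar_state_gt0 mJ) => //=.
  move=> b; have := side_card_rm side b vP; have := P0 b.
  by have [<-|_] := eqVneq (side v) b; lia.
by have := side_card_total_rm vP; move: sz; clear; lia.
Qed.

Let P_rm_gt0 v b : v \in P -> (1 < side_card P (side v))%N -> (0 < side_card (P :\ v) b)%N.
Proof.
move=> vP cv; have := side_card_rm side b vP; have := P0 b.
by have [<-|_] := eqVneq (side v) b; lia.
Qed.

Section Connected.
Variable f : V + V -> K.
Hypothesis f_adj : forall i j, i != j -> active J P i -> active J P j -> 0 < A i j -> f i = f j.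

Let f_lr u v : active J P (inl u) -> active J P (inr v) -> f (inl u) = f (inr v).
Proof.
move=> uJ va; apply: f_adj => //; move: va => /andP[vP cv].
rewrite /A polar_dirl polar_dirr //.
apply: (polar_state_gt0 (contract_m_convex u mJ)) => //= [b|]; first exact: P_rm_gt0.
have := contract_degree_gt0 mJ uJ; have := side_card_total_rm vP; move: sz; clear; lia.
Qed.

Let f_ll u v : u != v -> contract v (contract u J) != [::] -> f (inl u) = f (inl v).
Proof.
move=> uv vuJ; have mu := contract_m_convex u mJ.
have uJ : contract u J != [::] by apply: contraNneq vuJ => ->.
have vJ : contract v J != [::].
  by move: vuJ; rewrite contractC; apply: contraNneq => ->.
apply: f_adj => //; rewrite /A !polar_dirl.
apply: (polar_state_gt0 (contract_m_convex v mu)) => //=.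
have := contract_degree_gt0 mJ uJ; have := contract_degree_gt0 mu vuJ.
by move: sz; clear; lia.
Qed.

Let f_rr u v : u != v -> active J P (inr u) -> active J P (inr v) ->
  (0 < side_card (P :\ u :\ v) (side u))%N -> f (inr u) = f (inr v).
Proof.
move=> uv ua va cuv; apply: f_adj => //.
move: ua va => /andP[uP cu] /andP[vP cv].
have vPu : v \in P :\ u by rewrite !inE eq_sym uv.
rewrite /A polar_dir_rr //; apply: (polar_state_gt0 mJ) => //= [b|].
  have [<- //|ub] := eqVneq (side u) b.
  have := side_card_rm side b uP; have := side_card_rm side b vPu; have := P0 b.
  by rewrite (negPf ub); have [<-|_] := eqVneq (side v) b; move: cv; clear; lia.
have := side_card_total_rm vPu; have := side_card_total_rm uP.
by move: sz; clear; lia.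
Qed.

(** An active contraction and an active facet are always adjacent, which settles the case where both
    kinds occur. With contractions only, each side has one point and M-convexity connects. With
    facets only, [d] = 0 and there are at least five points; two facets are adjacent unless they
    come from a side of exactly two points, and then any facet of the other side, which has at least
    three, is adjacent to both. *)
Lemma facets_connected i j : active J P i -> active J P j -> f i = f j.
Proof.
have lls u v : active J P (inl u) -> active J P (inl v) -> f (inl u) = f (inl v).
  move=> uJ vJ.
  have [/existsP[w wa]|/existsPn nw] := boolP [exists w, active J P (inr w)].
    by rewrite (f_lr uJ wa) (f_lr vJ wa).
  have P1 b : side_card P b = 1%N.
    apply/eqP; rewrite eqn_leq P0 andbT leqNgt; apply/negP => Pb.
    have /card_gt0P[w] := P0 b; rewrite inE => /andP[wP /eqP wb].
    by have := nw w; rewrite /= wP wb Pb.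
  have d1 : (1 < d)%N by move: sz; rewrite !P1; clear; lia.
  have [x [ux xv]] := m_convex_connected mJ d1 uJ vJ.
  transitivity (f (inl x)); first by case: ux => [->|[]] //; exact: f_ll.
  by case: xv => [->|[]] //; exact: f_ll.
have rrs u v : active J P (inr u) -> active J P (inr v) -> f (inr u) = f (inr v).
  move=> ua va; have [->//|uv] := eqVneq u v.
  have [/existsP[w wa]|/existsPn nw] := boolP [exists w, active J P (inl w)].
    by rewrite -(f_lr wa ua) -(f_lr wa va).
  have d0 : d = 0%N.
    apply/eqP; rewrite -leqn0 leqNgt; apply/negP => d0.
    have [_ sJ _] := mJ; have [q qJ] : exists q, q \in J by case: {+}J J0 => // q s _; exists q;
      exact: mem_head.
    have [|x qx] := @exists_pos _ q; first by rewrite sJ.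
    by have := nw x; have := lower_mem qJ qx; rewrite /= negbK => /[swap] /eqP ->.
  have /andP[uP cu] := ua; have /andP[vP cv] := va.
  have vPu : v \in P :\ u by rewrite !inE eq_sym uv.
  have E1 b := side_card_rm side b uP; have E2 b := side_card_rm side b vPu.
  have [suv|suv] := eqVneq (side u) (side v); last first.
    apply: f_rr => //; move: cu.
    by rewrite E1 E2 eqxx (eq_sym (side v)) (negPf suv); clear; lia.
  have [c3|c2] := ltnP 2 (side_card P (side u)).
    by apply: f_rr => //; move: c3; rewrite E1 E2 suv eqxx; clear; lia.
  have co : (1 < side_card P (~~ side u))%N.
    by move: sz; rewrite d0; move: c2; case: (side u) => /=; clear; lia.
  have /card_gt0P[w] : (0 < side_card P (~~ side u))%N by exact: ltnW.
  rewrite inE => /andP[wP /eqP wb].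
  have wa : active J P (inr w) by rewrite /= wP wb co.
  have sw x : side x = side u -> active J P (inr x) -> f (inr x) = f (inr w).
    move=> xu xa; have xw : x != w by apply/eqP => xw; move: wb; rewrite -xw xu; case: (side u).
    have /andP[xP cx] := xa.
    have wPx : w \in P :\ x by rewrite !inE eq_sym xw.
    apply: f_rr => //; move: cx; rewrite (side_card_rm _ _ xP) (side_card_rm _ _ wPx) eqxx wb xu.
    by case: (side u) => /=; clear; lia.
  by rewrite (sw u) // (sw v).
case: i j => [u|u] [v|v] ui vj; [exact: lls|exact: f_lr|apply/esym; exact: f_lr|exact: rrs].
Qed.

End Connected.

(** Rescaled so that the all-ones vector represents [y0]; the row sums [r] are then pairings with
    [y0]. *)
Let a i j := c i * c j * A i j.
Let r i := \sum_j a i j.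

Let rE i : r i = c i * polar (dir P i :: y0 :: y0 :: ys) J P level0.
Proof.
rewrite polar_swap polar_expand // mulr_sumr; apply: eq_bigr => j _.
by rewrite /a mulrA [A i j]AC.
Qed.

Let ray_gt0 i : active J P i -> 0 < r i.
Proof. by move=> ia; rewrite rE mulr_gt0 ?c_gt0 ?r_gt0. Qed.

Let a_inactive i j : ~~ active J P i -> a i j = 0.
Proof. by move=> ia; rewrite /a /A polar_inactive // mulr0. Qed.

Let active_ray i : 0 < r i -> active J P i.
Proof.
by apply: contraTT => ia; rewrite /r big1 ?ltxx // => j _; exact: a_inactive.
Qed.

Let facet_ineq i (z : wvec) : active J P i ->
  polar (dir P i :: y0 :: y0 :: ys) J P level0 * polar (dir P i :: z :: z :: ys) J P level0 <=
  polar (dir P i :: y0 :: z :: ys) J P level0 ^+ 2.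
Proof.
case: i => [u uJ|v /andP[vP cv]].
  rewrite !polar_dirl; apply: IH (contract_m_convex u mJ) _.
  by have := contract_degree_gt0 mJ uJ; move: sz; clear; lia.
rewrite !polar_dirr //; apply: IH mJ _.
by have := side_card_total_rm vP; move: sz; clear; lia.
Qed.

Let a_form (x : V + V -> K) : let z := [ffun l => \sum_j (c j * x j) * dir P j l] in
  \sum_i \sum_j a i j * x i * x j = polar [:: z, z, y0 & ys] J P level0 /\
  forall i, \sum_j a i j * x j = c i * polar [:: dir P i, y0, z & ys] J P level0.
Proof.
move=> z.
have row i : \sum_j a i j * x j = c i * polar [:: dir P i, z, y0 & ys] J P level0.
  rewrite polar_swap polar_lin mulr_sumr; apply: eq_bigr => j _.
  by rewrite /a [A i j]AC /A; ring.
split=> [|i]; last first.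
  by rewrite row; congr (_ * _); apply: polar_congr => *; exact: polar_swap.
rewrite [RHS]polar_lin; apply: eq_bigr => i _.
transitivity (x i * \sum_j a i j * x j); last by rewrite row; ring.
by rewrite mulr_sumr; apply: eq_bigr => j _; ring.
Qed.

(** Since [y0] is the sum of the [c i * dir P i], the form at [z] is the positive combination of its
    values [s] on the facets. The induction hypothesis [q * s <= t ^+ 2] bounds each of them by
    [t ^+ 2 / q], and [c i * q] is the row sum. *)
Let weighted_ineq (x : V + V -> K) :
  \sum_i \sum_j a i j * x i * x j <= \sum_i (\sum_j a i j * x j) ^+ 2 / r i.
Proof.
have [] := a_form x; set z := finfun _ => -> row.
have -> : polar [:: z, z, y0 & ys] J P level0 = polar [:: y0, z, z & ys] J P level0.
  rewrite [RHS]polar_swap; apply: polar_congr => *; exact: polar_swap.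
rewrite polar_expand //; apply: ler_sum => i _; rewrite row rE -/(c i).
have [ia|ia] := boolP (active J P i); last first.
  by rewrite !polar_inactive // !mulr0 expr0n mul0r.
have ci := c_gt0 ia; have qi := r_gt0 ia; have := facet_ineq z ia.
set q := polar [:: _, y0, y0 & _] _ _ _ in qi *; set s := polar [:: _, z, z & _] _ _ _.
set t := polar [:: _, y0, z & _] _ _ _ => H.
rewrite ler_pdivlMr ?mulr_gt0 // exprMn.
rewrite (_ : c i * s * (c i * q) = c i ^+ 2 * (q * s)); last by ring.
by rewrite ler_wpM2l ?sqr_ge0.
Qed.

Lemma polar_negative_orthogonal (z : wvec) : polar [:: z, y0, y0 & ys] J P level0 = 0 ->
  polar [:: z, z, y0 & ys] J P level0 <= 0.
Proof.
move=> zy0; pose x i := dir_coord P z i / c i.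
(* [c i] vanishes only for facets at points outside [P], where the coordinate of [z] vanishes too,
   so the value of a division by 0 is harmless. *)
have zE i : dir_coord P z i = c i * x i.
  have [ci|ci] := eqVneq (c i) 0; last by rewrite /x mulrCA mulfV ?mulr1.
  rewrite ci mul0r; case: i ci => [u|v] /=.
    have y0l l : 0 < y0 l by rewrite ys0 ?mem_head.
    move/eqP; rewrite gt_eqF // ltr_pwDl // mulr_ge0 ?ler0n // divr_ge0 ?ler0n //.
    exact: ltW.
  rewrite /c /=; case: (v \in P); last by rewrite !mul0r.
  rewrite !mul1r => /eqP; rewrite mulf_eq0 invr_eq0 pnatr_eq0 => /orP[/eqP y00|/eqP P00].
    by have := ys0 (mem_head _ _) (inr (side v)); rewrite y00 ltxx.
  by have := P0 (side v); rewrite P00.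
have zw ws k : polar ([ffun l => \sum_j (c j * x j) * dir P j l] :: ws) J P k = polar (z :: ws) J
  P k.
  by rewrite polar_lin polar_expand //; apply: eq_bigr => i _; rewrite -zE.
have [Ez _] := a_form x.
rewrite zw polar_swap zw in Ez.
rewrite -Ez; apply: local_to_global.
- by move=> i j; rewrite /a AC [c i * _]mulrC.
- by move=> i j ij; rewrite !mulr_ge0 ?A_ge0.
- move=> i; have [ia|ia] := boolP (active J P i); first by left; exact: ray_gt0.
  by right=> j; exact: a_inactive.
- move=> f fa i j /active_ray ia /active_ray ja.
  apply: facets_connected => // i' j' ij ia' ja' Aij.
  by apply: fa => //; rewrite !mulr_gt0 ?c_gt0.
- exact: weighted_ineq.
rewrite -[RHS]zy0 polar_expand //; apply: eq_bigr => i _.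
by rewrite -/(r i) rE zE; ring.
Qed.

End Step.
(** Induction on the number of frozen directions. The next one, [y0], also serves as test direction:
    the form is nonpositive on the hyperplane orthogonal to it, and every plane through [y] meets
    that hyperplane. *)
Lemma polar_hyperbolic d J P ys (y z : wvec) : m_convex d J ->
  (d + side_card P false + side_card P true = size ys + 4)%N ->
  (forall w, w \in y :: ys -> forall l, 0 < w l) ->
  polar [:: y, y & ys] J P level0 * polar [:: z, z & ys] J P level0 <=
  polar [:: y, z & ys] J P level0 ^+ 2.
Proof.
elim: ys d J P y z => [|y0 ys IH] d J P y z mJ sz pos.
  by apply: polar_hyperbolic0 mJ sz _ => l; apply: pos; rewrite mem_head.
have [J0|J0] := eqVneq J [::]; first by rewrite J0 !polar_nil mulr0 expr0n.
have [/existsP[b /eqP Pb]|/existsPn Pn] := boolP [exists b, side_card P b == 0%N].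
  by rewrite !(polar_no_side (b := b)) // expr0n mulr0.
have P0 b : (0 < side_card P b)%N by rewrite lt0n.
have pos' w : w \in y0 :: ys -> forall l, 0 < w l.
  by move=> wy; apply: pos; rewrite inE wy orbT.
have y_pos l : 0 < y l by apply: pos; rewrite mem_head.
have sz' : (d + side_card P false + side_card P true = size ys + 5)%N by rewrite sz /=; lia.
have neg x : polar [:: x, y0, y0 & ys] J P level0 = 0 -> polar [:: x, x, y0 & ys] J P level0 <= 0.
  apply: (polar_negative_orthogonal mJ J0 P0 sz' pos') => J' P' d' x' mJ' sJ'.
  exact: IH mJ' sJ' pos'.
have pos3 : 0 < polar [:: y, y0, y0 & ys] J P level0.
  apply: (polar_state_gt0 mJ) => //=; first by rewrite sz'; lia.
  move=> w; rewrite inE => /orP[/eqP -> //|]; rewrite inE => /orP[/eqP ->|]; apply: pos'.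
  exact: mem_head.
have yy0 : 0 <= polar [:: y, y, y0 & ys] J P level0.
  apply: polar_ge0 => w; rewrite inE => /orP[/eqP -> l|wy l]; first exact: ltW.
  exact/ltW/pos.
(* With these coefficients [s y - t z] pairs to 0 with [y0]. *)
apply: (@negative_hyperplane _ _ _ _ (polar [:: z, y0, y0 & ys] J P level0)
  (polar [:: y, y0, y0 & ys] J P level0)) => //; first by rewrite gt_eqF.
set s := polar [:: z, y0, y0 & ys] J P level0; set t := polar [:: y, y0, y0 & ys] J P level0.
have := polar_combination side s (- t) y z (y0 :: ys) J P level0.
set x := finfun _ => E.
have : polar [:: x, x, y0 & ys] J P level0 <= 0.
  by apply: neg; rewrite polar_lin2 -/s -/t; ring.
rewrite E; lra.
Qed.

End HyperbolicStep.

(** * Limits to boundary directions, and log-concave sequences *)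

Lemma horner_lipschitz (K : realFieldType) (p : {poly K}) :
  exists2 M, 0 <= M & forall x, 0 <= x <= 1 -> `|p.[x] - p.[0]| <= M * x.
Proof.
elim/poly_ind: p => [|p c [M M0 pM]].
  by exists 0 => // x _; rewrite !horner0 subrr normr0 mul0r.
exists (`|p.[0]| + M) => [|x x01]; first by rewrite addr_ge0.
have /andP[x0 x1] := x01.
rewrite !hornerMXaddC mulr0 add0r addrK normrM (ger0_norm x0) ler_wpM2r //.
have := pM x x01; have := ler_normD (p.[x] - p.[0]) p.[0]; rewrite subrK.
have : M * x <= M by rewrite ler_piMr.
lra.
Qed.

(** A limit at 0 from the right over any ordered field: if [p.[0]] were negative, the Lipschitz
    bound would keep [p] negative at the small positive [x] chosen below. *)
Lemma horner0_ge0 (K : realFieldType) (p : {poly K}) :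
  (forall x, 0 < x -> 0 <= p.[x]) -> 0 <= p.[0].
Proof.
move=> p0; rewrite leNgt; apply/negP => pneg.
have [M M0 pM] := horner_lipschitz p.
pose x := Num.min 1 (- p.[0] / (2 * (M + 1))).
have x0 : 0 < x by rewrite lt_min ltr01 divr_gt0 //; lra.
have x1 : x <= 1 by rewrite ge_min lexx.
have := p0 x x0; have := pM x; rewrite (ltW x0) x1 => /(_ isT).
have : M * x <= - p.[0] / 2.
  have : x <= - p.[0] / (2 * (M + 1)) by rewrite ge_min lexx orbT.
  rewrite ler_pdivlMr; last lra.
  by nra.
by move=> H1 H2 H3; have := ler_norm (p.[x] - p.[0]); lra.
Qed.

Section Count.
Variables (V : finType) (side : V -> bool).
Local Notation vec := {ffun V -> nat}.
Local Notation level0 := ([ffun=> 0%N] : {ffun bool -> nat}).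
Implicit Types (J : seq vec) (P : {set V}).

Lemma polar_rmorph (R S : comNzRingType) (f : {rmorphism R -> S}) ws J P k :
  f (polar side ws J P k) = polar side [seq [ffun l => f (w l)] | w : {ffun V + bool -> R} <- ws]
    J P k.
Proof.
elim: ws J k => [|w ws IH] J k /=; first exact: rmorph_nat.
rewrite rmorphD !rmorph_sum; congr (_ + _); apply: eq_bigr => u _;
  by rewrite rmorphM IH ffunE.
Qed.

Definition level (R : nzRingType) (b : bool) : {ffun V + bool -> R} :=
  [ffun l => (l == inr b)%:R].

Lemma polar_level (R : comNzRingType) b ws J P k :
  polar side (level R b :: ws) J P k = polar side ws J P (raise k b).
Proof.
rewrite /= big1 => [|u _]; last by rewrite ffunE mul0r.
rewrite add0r (bigD1 b) //= big1 => [|b' /negPf bb]; rewrite ffunE.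
  by rewrite eqxx mul1r addr0.
by rewrite (_ : (inr b' == inr b) = false) ?mul0r.
Qed.

Lemma polar_levels (R : comNzRingType) bs J P k :
  polar side (map (level R) bs) J P k = (count (fits side P (foldl raise k bs)) J)%:R.
Proof. by elim: bs k => //= b bs IH k; rewrite -IH -polar_level. Qed.

Lemma raise_count k bs : foldl raise k bs = [ffun b => (k b + count_mem b bs)%N].
Proof.
elim: bs k => [|b bs IH] k /=; first by apply/ffunP => b; rewrite ffunE addn0.
by rewrite IH; apply/ffunP => x; rewrite !ffunE eq_sym addnA.
Qed.

(** The directions [level b] have zero coordinates, while hyperbolicity is proved for positive ones.
    Adding ['X] to all coordinates makes them positive at every x > 0; both sides are polynomials in
    x, and their values at 0 are the counts. *)
Lemma count_fits_log_concave d J P b1 b2 bs : m_convex d J ->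
  (d + side_card side P false + side_card side P true = size bs + 4)%N ->
  (count (fits side P (foldl raise level0 [:: b1, b1 & bs])) J *
   count (fits side P (foldl raise level0 [:: b2, b2 & bs])) J <=
   count (fits side P (foldl raise level0 [:: b1, b2 & bs])) J ^ 2)%N.
Proof.
move=> mJ sz.
pose shift b : {ffun V + bool -> {poly rat}} := [ffun l => level {poly rat} b l + 'X].
pose F b b' := polar side (map shift [:: b, b' & bs]) J P level0.
have FE x b b' : (F b b').[x] =
    polar side [seq [ffun l => level rat c l + x] | c <- [:: b, b' & bs]] J P level0.
  rewrite -[LHS]/(horner_eval x (F b b')) polar_rmorph -map_comp.
  congr (polar _ _ _ _ _); apply: eq_map => c; apply/ffunP => l; rewrite !ffunE /=.
  by rewrite /horner_eval !hornerE; case: (l == inr c); rewrite ?hornerE.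
have F0 b b' : (F b b').[0] = (count (fits side P (foldl raise level0 [:: b, b' & bs])) J)%:R.
  rewrite FE -polar_levels; congr (polar _ _ _ _ _); apply: eq_map => c.
  by apply/ffunP => l; rewrite !ffunE addr0.
have := @horner0_ge0 _ (F b1 b2 ^+ 2 - F b1 b1 * F b2 b2).
rewrite hornerD hornerN horner_exp hornerM !F0 subr_ge0 -natrM -natrX ler_nat; apply => x x0.
rewrite hornerD hornerN horner_exp hornerM subr_ge0 !FE !map_cons.
apply: (polar_hyperbolic _ mJ); first by rewrite size_map.
move=> w; rewrite -map_cons => /mapP[c _ ->] l; rewrite !ffunE.
by rewrite ltr_wpDl ?ler0n.
Qed.

End Count.

(** Ratios of consecutive terms do not increase, so a weak descent stays weak and a strict one
    strict. [k] is the first index without ascent and [m] the first one from [k] on without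
    equality, both capped by the degree. *)
Lemma log_concave_trapezoidal (K : realDomainType) (p : {poly K}) :
  (forall i, (i <= (size p).-1)%N -> 0 < p`_i) -> log_concave p -> trapezoidal p.
Proof.
set n := (size p).-1 => p_gt0 lc.
have le_next i : (i.+1 < n)%N -> p`_i.+1 <= p`_i -> p`_i.+2 <= p`_i.+1.
  move=> iN le; have := lc i.+1; rewrite /= -/n iN => /(_ isT) H.
  have := p_gt0 i; have := p_gt0 i.+1.
  by rewrite (ltnW iN) (ltnW (ltnW iN)) => /(_ isT) p1 /(_ isT) p0; nra.
have lt_next i : (i.+1 < n)%N -> p`_i.+1 < p`_i -> p`_i.+2 < p`_i.+1.
  move=> iN le; have := lc i.+1; rewrite /= -/n iN => /(_ isT) H.
  have := p_gt0 i; have := p_gt0 i.+1.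
  by rewrite (ltnW iN) (ltnW (ltnW iN)) => /(_ isT) p1 /(_ isT) p0; nra.
have exk : exists i, (n <= i)%N || (p`_i.+1 <= p`_i) by exists n; rewrite leqnn.
have [k kP kmin] := ex_minnP exk.
have exm : exists i, (k <= i)%N && ((n <= i)%N || (p`_i != p`_i.+1)).
  by exists (maxn k n); rewrite leq_maxl leq_maxr.
have [m /andP[km mP] mmin] := ex_minnP exm.
have kn : (k <= n)%N by apply: kmin; rewrite leqnn.
have mn : (m <= n)%N by apply: mmin; rewrite kn leqnn.
exists k, m; split.
- by rewrite km mn.
- move=> i ik; rewrite ltNge; apply/negP => H.
  by have := kmin i; rewrite H orbT leqNgt ik => /(_ isT).
- move=> i /andP[ki im]; apply/eqP/negPn/negP => H.
  by have := mmin i; rewrite ki H orbT leqNgt im => /(_ isT).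
move=> i /andP[mi iN].
elim: i mi iN => [|i IH] mi iN; last first.
  move: mi; rewrite leq_eqVlt => /orP[/eqP mE|mi]; last first.
    by apply: lt_next => //; apply: IH => //; exact: ltnW.
  move: mP; rewrite mE leqNgt iN /= => neq; rewrite lt_neqAle eq_sym neq /=.
  move: km; rewrite mE leq_eqVlt => /orP[/eqP kE|ki].
    by move: kP; rewrite kE leqNgt iN.
  apply: le_next => //.
  have /negPn/eqP-> // : ~~ (p`_i != p`_i.+1).
  by apply/negP => H; have := mmin i; rewrite -ltnS ki H orbT mE ltnn => /(_ isT).
have m0 : m = 0%N by apply/eqP; rewrite -leqn0.
have k0 : k = 0%N by apply/eqP; rewrite -leqn0 -m0.
move: mP kP; rewrite m0 k0 leqNgt iN /= => neq le.
by rewrite lt_neqAle eq_sym neq.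
Qed.

(** * Cycles, trees and flows *)

(** The submatrix of [M] with rows [A] and columns [B] has independent rows. Both bounds on the
    number of edges of a tree come from this. *)
Lemma card_le_of_injective (K : fieldType) (I J : finType) (M : I -> J -> K)
    (A : {set I}) (B : {set J}) :
  (forall lam : I -> K, (forall i, i \notin A -> lam i = 0) ->
     (forall j, j \in B -> \sum_i lam i * M i j = 0) -> forall i, lam i = 0) ->
  (#|A| <= #|B|)%N.
Proof.
move=> inj.
pose N := \matrix_(a < #|A|, b < #|B|) M (enum_val a) (enum_val b).
suff : row_free N by move/eqP <-; exact: rank_leq_col.
apply: inj_row_free => x xN.
pose lam i := if [pick a | enum_val a == i :> I] is Some a then x 0 a else 0.
have lamE a : lam (enum_val a) = x 0 a.
  rewrite /lam; case: pickP => [b /eqP /enum_val_inj -> //|/(_ a)].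
  by rewrite eqxx.
have lam_out i : i \notin A -> lam i = 0.
  rewrite /lam; case: pickP => [b /eqP <-|//]; by rewrite enum_valP.
have sumE (F : I -> K) : (forall i, i \notin A -> F i = 0) ->
    \sum_i F i = \sum_(a < #|A|) F (enum_val a).
  move=> F0; rewrite (bigID (mem A)) /= [X in _ + X]big1 // addr0.
  exact: big_enum_val.
apply/rowP => a; rewrite mxE -lamE; apply: inj => // j jB.
rewrite sumE => [|i /lam_out ->]; last by rewrite mul0r.
have := congr1 (fun y : 'rV_ _ => y 0 (enum_rank_in jB j)) xN.
rewrite [LHS]mxE [RHS]mxE => E; rewrite -[RHS]E.
by apply: eq_bigr => b _; rewrite mxE lamE enum_rankK_in.
Qed.

Section Boundary.
Variable G : digraph.
Hypothesis loopless : forall e : edge G, source e != target e.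
Local Notation V := (vert G).
Local Notation E := (edge G).

Definition incidence (K : nzRingType) (e : E) (v : V) : K :=
  (v == source e)%:R - (v == target e)%:R.

Definition boundary (K : nzRingType) (lam : E -> K) (v : V) : K :=
  \sum_e lam e * incidence K e v.

Definition touches (e : E) (v : V) : bool := (source e == v) || (target e == v).

Lemma incidence_eq0 (K : nzRingType) e v : (incidence K e v == 0) = ~~ touches e v.
Proof.
rewrite /incidence /touches.
have [sv|_] := eqVneq (source e) v; have [tv|_] := eqVneq (target e) v => /=.
- by have := loopless e; rewrite sv tv eqxx.
- by rewrite subr0 oner_eq0.
- by rewrite sub0r oppr_eq0 oner_eq0.
- by rewrite subrr eqxx.
Qed.

Lemma boundaryE (K : idomainType) (lam : E -> K) e v : boundary lam v = 0 ->
  lam e != 0 -> touches e v -> exists e', [/\ e' != e, lam e' != 0 & touches e' v].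
Proof.
move=> b0 le ev.
have [/existsP[e' /and3P[? ? ?]]|/existsPn H] :=
  boolP [exists e', [&& e' != e, lam e' != 0 & touches e' v]]; first by exists e'.
move: b0; rewrite /boundary (bigD1 e) //= big1 => [/eqP|e' e'e].
  by rewrite addr0 mulf_eq0 (negPf le) incidence_eq0 ev.
have := H e'; rewrite e'e /= negb_and negbK => /orP[/eqP ->|]; first by rewrite mul0r.
by rewrite -(incidence_eq0 K) => /eqP ->; rewrite mulr0.
Qed.

Definition opposite (e : E) (v : V) : V := if source e == v then target e else source e.

Lemma joins_opposite e v : touches e v -> joins e v (opposite e v).
Proof.
rewrite /touches /joins /opposite; case: ifP => [/eqP sv|sv] /=; rewrite ?eqxx //.
Qed.

Lemma touches_opposite e v : touches e (opposite e v).
Proof. by rewrite /touches /opposite; case: ifP; rewrite eqxx ?orbT. Qed.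

Lemma touches_joins e u v x : joins e u v -> touches e x -> x = u \/ x = v.
Proof.
by case/orP => /andP[/eqP <- /eqP <-] /orP[] /eqP ->; [left|right|right|left].
Qed.

(* Follow edges of the support without backtracking until a vertex repeats. *)
Lemma cycle_in_support (K : idomainType) (lam : E -> K) e0 :
  (forall v, boundary lam v = 0) -> lam e0 != 0 ->
  exists2 C, is_cycle C & forall e, e \in C -> lam e != 0.
Proof.
move=> b0 l0.
pose good (x : V * E) := touches x.2 x.1 && (lam x.2 != 0).
pose nxt (x : V * E) : V * E :=
  let v := opposite x.2 x.1 in
  (v, odflt x.2 [pick e' | [&& e' != x.2, lam e' != 0 & touches e' v]]).
have nxtP x : good x -> good (nxt x) /\ (nxt x).2 != x.2.
  case: x => v e /andP[/= ev le].
  have [e' [e'e le' te']] := boundaryE (b0 (opposite e v)) le (touches_opposite e v).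
  rewrite /nxt /good /=; case: pickP => [e1 /and3P[-> -> ->] //|/(_ e')].
  by rewrite e'e le' te'.
pose x n := iter n nxt (source e0, e0).
have xS n : x n.+1 = nxt (x n) by [].
have x_good n : good (x n).
  by elim: n => [|n IH]; [rewrite /good /touches /= eqxx l0 | have [] := nxtP _ IH].
pose w n := (x n).1; pose c n := (x n).2.
have cw n : touches (c n) (w n) by have /andP[] := x_good n.
have cj n : joins (c n) (w n) (w n.+1) by rewrite /w xS; apply: joins_opposite.
have cS n : c n.+1 != c n by rewrite /c xS; have [] := nxtP _ (x_good n).
have ex_rep : exists j, [exists i : 'I_j, w i == w j].
  have /injectivePn[i [j ij wij]] : ~~ injectiveb (fun i : 'I_(#|V|).+1 => w i).
    by apply/injectiveP => /leq_card; rewrite card_ord ltnn.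
  wlog lt : i j ij wij / (i < j)%N.
    move=> H; have [|lt|/val_inj eq] := ltngtP i j; first exact: H.
      by apply: (H j i) => //; rewrite eq_sym.
    by rewrite eq eqxx in ij.
  by exists j; apply/existsP; exists (Ordinal lt); apply/eqP.
have [j /existsP[i /eqP wij] jmin] := ex_minnP ex_rep.
have w_inj a b : (a < j)%N -> (b < j)%N -> w a = w b -> a = b.
  wlog lt : a b / (a < b)%N.
    move=> H aj bj ab; have [lt|lt|//] := ltngtP a b; first exact: H.
    by apply/esym; apply: H.
  move=> _ bj ab; have := jmin b; rewrite leqNgt bj; case/(_ _)/negP => //.
  by apply/existsP; exists (Ordinal lt); apply/eqP.
have c_inj a b : (a < j)%N -> (b < j)%N -> c a = c b -> a = b.
  wlog lt : a b / (a < b)%N.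
    move=> H aj bj ab; have [lt|lt|//] := ltngtP a b; first exact: H.
    by apply/esym; apply: H.
  move=> aj bj ab; have := cw b; rewrite -ab => /(touches_joins (cj a)) [] eq.
    by apply/esym; apply: w_inj.
  have ba : b = a.+1 by apply: w_inj => //; exact: leq_ltn_trans lt bj.
  by have := cS a; rewrite -ba ab eqxx.
have ij := ltn_ord i.
have [k kE] : exists k, (j - i)%N = k.+1 by exists (j - i).-1; lia.
exists [set c (i + t)%N | t : 'I_k.+1]; last first.
  by move=> e /imsetP[t _ ->]; have /andP[] := x_good (i + t)%N.
have tj (t : 'I_k.+1) : (i + t < j)%N by have := ltn_ord t; lia.
exists k, (fun t => w (i + t)%N), (fun t => c (i + t)%N); split=> //.
- by move=> s t /(w_inj _ _ (tj s) (tj t)) /addnI /val_inj.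
- by move=> s t /(c_inj _ _ (tj s) (tj t)) /addnI /val_inj.
move=> t; have := cj (i + t)%N; rewrite -addnS /=.
have [lt|ge] := ltnP t.+1 k.+1; first by rewrite modn_small.
have tk : nat_of_ord t = k by apply/eqP; rewrite eqn_leq -ltnS ltn_ord.
by rewrite tk modnn addn0 -kE subnKC ?wij // ltnW.
Qed.

Lemma sum_incidence (K : nzRingType) e : \sum_v incidence K e v = 0.
Proof.
rewrite /incidence sumrB (bigD1 (source e)) //= eqxx big1 => [|v /negPf -> //].
by rewrite [X in _ - X](bigD1 (target e)) //= eqxx big1 => [|v /negPf -> //]; rewrite subrr.
Qed.

(** The coefficient is 1 on the edges traversed from source to target and -1 on the others; the
    boundary telescopes around the cycle. *)
Lemma cycle_dependence (C : {set E}) : is_cycle C -> exists lam : E -> int,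
  [/\ forall v, boundary lam v = 0, forall e, e \in C -> `|lam e| = 1 &
      forall e, e \notin C -> lam e = 0].
Proof.
move=> [k [w [c [w_inj c_inj wc ->]]]].
pose s i : int := if source (c i) == w i then 1 else -1.
pose lam e : int := \sum_i (c i == e)%:R * s i.
have lam_c i : lam (c i) = s i.
  rewrite /lam (bigD1 i) //= eqxx mul1r big1 ?addr0 // => i' ii'.
  by rewrite (inj_eq c_inj) (negPf ii') mul0r.
exists lam; split.
- move=> v; rewrite /boundary /lam.
  under eq_bigr do rewrite mulr_suml.
  rewrite exchange_big /=.
  transitivity (\sum_i ((v == w i)%:R - (v == w (ordS i))%:R) : int).
    apply: eq_bigr => i _; rewrite (bigD1 (c i)) //= eqxx mul1r big1 ?addr0; last first.
      by move=> e /negPf; rewrite eq_sym => ->; rewrite !mul0r.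
    rewrite /incidence /s; have := wc i; rewrite /joins.
    case: ifP => [/eqP -> /=|_ /= /andP[/eqP -> /eqP ->]]; last by ring.
    by case/orP => [/eqP ->|/andP[/eqP -> /eqP ->]]; rewrite mul1r.
  rewrite sumrB [X in X - _](reindex (@ordS k.+1)) ?subrr //.
  exact/onW_bij/ordS_bij.
- by move=> e /imsetP[i _ ->]; rewrite lam_c /s; case: ifP.
move=> e eC; apply: big1 => i _; case: eqP => [ce|]; last by rewrite mul0r.
by rewrite -ce imset_f in eC.
Qed.

Lemma connected_boundary (F : {set E}) u v : connect (adjacent F) u v ->
  exists2 lam : E -> int, forall e, e \notin F -> lam e = 0 &
    forall x, boundary lam x = (x == u)%:R - (x == v)%:R.
Proof.
case/connectP => p; elim: p u => [|y p IH] u /=.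
  move=> _ ->; exists (fun=> 0) => // x.
  by rewrite subrr /boundary big1 // => e _; rewrite mul0r.
case/andP => /existsP[e /andP[eF uy]] /IH{}IH /IH[lam lF lb].
pose s : int := if source e == u then 1 else -1.
exists (fun e' => (e' == e)%:R * s + lam e').
  move=> e' e'F; rewrite lF // addr0; case: eqP => [ee|]; last by rewrite mul0r.
  by rewrite ee eF in e'F.
move=> x; rewrite /boundary.
under eq_bigr do rewrite mulrDl.
rewrite big_split /= -/(boundary lam x) lb (bigD1 e) //= eqxx mul1r big1 ?addr0; last first.
  by move=> e' /negPf ->; rewrite !mul0r.
rewrite /s /incidence; move: uy; rewrite /joins.
case: ifP => [/eqP -> /=|_ /= /andP[/eqP -> /eqP ->]]; last by ring.
by case/orP => [/eqP ->|/andP[/eqP -> /eqP ->]]; ring.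
Qed.

End Boundary.

(** * Spanning trees: ranks, fundamental cycles and fundamental cuts *)

Section Trees.
Variable G : digraph.
Hypothesis loopless : forall e : edge G, source e != target e.
Local Notation V := (vert G).
Local Notation E := (edge G).
Implicit Types (T F C : {set E}) (S : {set V}).

Definition acyclic F : Prop := forall C, is_cycle C -> ~~ (C \subset F).

Lemma acyclic_kernel (K : idomainType) F (lam : E -> K) : acyclic F ->
  (forall e, e \notin F -> lam e = 0) -> (forall v, boundary lam v = 0) ->
  forall e, lam e = 0.
Proof.
move=> acF lF b0 e; apply/eqP; apply: contraT => le.
have [C cC lC] := cycle_in_support loopless b0 le.
have /negP[] := acF C cC; apply/subsetP => e' /lC.
by apply: contraNT => /lF ->.
Qed.

Lemma cut_incidence (K : nzRingType) S (e : E) :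
  \sum_(v in S) incidence K e v = (source e \in S)%:R - (target e \in S)%:R.
Proof.
have ind x : \sum_(v in S) (v == x)%:R = (x \in S)%:R :> K.
  rewrite big_mkcond (bigD1 x) //= eqxx big1 ?addr0; first by case: (x \in S).
  by move=> v /negPf ->; case: ifP.
by rewrite /incidence sumrB !ind.
Qed.

Lemma cut_boundary (K : nzRingType) S (lam : E -> K) :
  \sum_(v in S) boundary lam v =
  \sum_e lam e * ((source e \in S)%:R - (target e \in S)%:R).
Proof.
rewrite exchange_big; apply: eq_bigr => e _.
by rewrite -mulr_sumr cut_incidence.
Qed.

Definition inside F S : {set E} := [set e in F | (source e \in S) && (target e \in S)].

(** The incidence columns of a forest stay independent when the row of [s] is dropped, because the
    boundary sums to 0 over all vertices. *)
Lemma acyclic_inside F S : acyclic F -> S != set0 -> (#|inside F S| < #|S|)%N.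
Proof.
move=> acF /set0Pn[s sS]; rewrite [X in (_ < X)%N](cardsD1 s) sS add1n ltnS.
apply: (@card_le_of_injective rat _ _ (incidence rat)) => lam l0 lb.
have lF e : e \notin F -> lam e = 0.
  by move=> eF; apply: l0; rewrite inE (negPf eF).
have out v : v \notin S -> boundary lam v = 0.
  move=> vS; apply: big1 => e _.
  have [/l0 ->|] := boolP (e \notin inside F S); first by rewrite mul0r.
  rewrite negbK inE => /and3P[_ se te]; rewrite /incidence.
  have /negPf-> : v != source e by apply: contraNneq vS => ->.
  have /negPf-> : v != target e by apply: contraNneq vS => ->.
  by rewrite subrr mulr0.
have off v : v != s -> boundary lam v = 0.
  move=> vs; have [vS|] := boolP (v \in S); last exact: out.
  by apply: lb; rewrite !inE vs.
apply: (acyclic_kernel acF lF) => v; have [->|/off //] := eqVneq v s.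
have : \sum_v boundary lam v = 0.
  rewrite exchange_big big1 // => e _.
  by rewrite -mulr_sumr sum_incidence mulr0.
by rewrite (bigD1 s) //= [X in _ + X]big1 ?addr0.
Qed.

Section Tree.
Variable T : {set E}.
Hypothesis tT : spanning_tree T.

Let cT : connected_by T. Proof. by case: tT. Qed.
Let acT : acyclic T. Proof. by case: tT. Qed.

Lemma tree_card : #|T|.+1 = #|V|.
Proof.
have [V0 conn] := cT.
apply/eqP; rewrite eqn_leq; apply/andP; split.
  have -> : T = inside T setT by apply/setP => e; rewrite !inE !andbT.
  rewrite -cardsT; apply: acyclic_inside => //.
  by rewrite -card_gt0 cardsT.
have /card_gt0P[r _] := V0.
rewrite -cardsT (cardsD1 r) inE add1n ltnS.
apply: (@card_le_of_injective rat _ _ (fun v e => incidence rat e v)) => phi phi0 H.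
have phir : phi r = 0 by apply: phi0; rewrite !inE eqxx.
have step u v : adjacent T u v -> phi u = phi v.
  move=> /existsP[e /andP[eT uv]]; have := H e eT.
  rewrite /incidence; under eq_bigr do rewrite mulrBr.
  rewrite sumrB (bigD1 (source e)) //= eqxx mulr1 big1 ?addr0; last first.
    by move=> x /negPf ->; rewrite mulr0.
  rewrite (bigD1 (target e)) //= eqxx mulr1 big1 ?addr0; last first.
    by move=> x /negPf ->; rewrite mulr0.
  move/eqP; rewrite subr_eq0 => /eqP st.
  by move: uv => /orP[] /andP[/eqP <- /eqP <-].
move=> v; rewrite -phir; case/connectP: (conn v r) => p.
elim: p v => [|y p IH] v /= ; first by move=> _ ->.
by case/andP => /step -> /IH{}IH /IH.
Qed.

Lemma tree_boundary (b : V -> int) : \sum_v b v = 0 ->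
  exists2 lam : E -> int, forall e, e \notin T -> lam e = 0 &
    forall v, boundary lam v = b v.
Proof.
move=> sb; have [V0 conn] := cT; have /card_gt0P[r _] := V0.
pose paths u (lam : E -> int) := (forall e, e \notin T -> lam e = 0) /\
  forall x, boundary lam x = (x == u)%:R - (x == r)%:R.
have /(@choice _ _ paths)[p pP] : forall u, exists lam, paths u lam.
  by move=> u; have [lam lT lb] := connected_boundary (conn u r); exists lam.
exists (fun e => \sum_u b u * p u e).
  move=> e eT; apply: big1 => u _; have [-> //] := pP u; by rewrite mulr0.
move=> v; rewrite /boundary; under eq_bigr do rewrite mulr_suml.
rewrite exchange_big /=.
transitivity (\sum_u (b u * (v == u)%:R - b u * (v == r)%:R)).
  apply: eq_bigr => u _; have [_ bu] := pP u; rewrite -mulrBr -bu mulr_sumr.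
  by apply: eq_bigr => e _; rewrite mulrA.
rewrite sumrB -mulr_suml sb mul0r subr0 (bigD1 v) //= eqxx mulr1 big1 ?addr0 // => u.
by rewrite eq_sym => /negPf ->; rewrite mulr0.
Qed.

(** The edge [e] is closed up by a tree walk, which may repeat edges. Its support still contains a
    cycle through [e], and comparison off [T] identifies the circulation with that cycle up to sign,
    whence the bound by 1. *)
Lemma fundamental_cycle e : e \notin T -> exists lam : E -> int,
  [/\ forall v, boundary lam v = 0, lam e = 1,
      forall e', e' \notin e |: T -> lam e' = 0,
      forall e', `|lam e'| <= 1 & is_cycle [set e' | lam e' != 0]].
Proof.
move=> eT; have [_ conn] := cT.
have [p pT pb] := connected_boundary (conn (target e) (source e)).
pose lam e' : int := (e' == e)%:R + p e'.
have lb v : boundary lam v = 0.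
  rewrite /boundary; under eq_bigr do rewrite mulrDl.
  rewrite big_split /= -/(boundary p v) pb (bigD1 e) //= eqxx mul1r big1 ?addr0.
    by rewrite /incidence; ring.
  by move=> e' /negPf ->; rewrite mul0r.
have le : lam e = 1 by rewrite /lam eqxx pT.
have lout e' : e' \notin e |: T -> lam e' = 0.
  by rewrite !inE negb_or => /andP[/negPf ne e'T]; rewrite /lam ne pT.
have le0 : lam e != 0 by rewrite le.
have [C cC lC] := cycle_in_support loopless lb le0.
have [mu [mb mC mout]] := cycle_dependence cC.
have eC : e \in C.
  have := acT cC; apply: contraNT => eC; apply/subsetP => e' e'C.
  have := lC e' e'C; apply: contraNT => e'T; rewrite lout //.
  by rewrite !inE negb_or e'T andbT; apply: contraNneq eC => <-.
have CT e' : e' \in C -> e' \in e |: T.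
  by move=> /lC; apply: contraNT => /lout ->.
have lmu e' : lam e' = mu e * mu e'.
  have mue : mu e * mu e = 1.
    by rewrite -expr2 -[LHS]ger0_norm ?sqr_ge0 // normrX (mC e eC) expr1n.
  apply/eqP; rewrite -subr_eq0; apply/eqP.
  apply: (acyclic_kernel (F := T) (lam := fun e' => lam e' - mu e * mu e')) => //.
    move=> e1 e1T; have [->|ne] := eqVneq e1 e; first by rewrite le mue subrr.
    have e1o : e1 \notin e |: T by rewrite !inE negb_or ne.
    have e1C : e1 \notin C by apply: contra e1o => /CT.
    by rewrite lout // (mout e1) // mulr0 subr0.
  move=> v; rewrite /boundary; under eq_bigr do rewrite mulrBl -mulrA.
  by rewrite sumrB -mulr_sumr -/(boundary lam v) -/(boundary mu v) lb mb mulr0 subr0.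
exists lam; split=> //.
  move=> e'; rewrite lmu normrM (mC e eC) mul1r.
  by have [/mC ->|/mout ->] := boolP (e' \in C); rewrite ?normr0.
rewrite (_ : [set e' | lam e' != 0] = C) //; apply/setP => e'; rewrite inE.
apply/idP/idP => [|/lC //]; rewrite lmu; apply: contraNT => /mout ->.
by rewrite mulr0.
Qed.

(** [S] is the component of the source of [e] in [T] without [e]. Both parts are forests, and the
    edge count of [T] makes both bounds sharp; the tree edges with target in [S] are those inside
    [S], as [e] leaves [S]. *)
Lemma tree_cut e : e \in T -> exists S, [/\ source e \in S, target e \notin S,
  (forall e', e' \in T -> e' != e -> (source e' \in S) = (target e' \in S)) &
  (#|[set e' in T | target e' \in S]|.+1 = #|S|)%N].
Proof.
move=> eT; pose S := [set v | connect (adjacent (T :\ e)) (source e) v].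
have sS : source e \in S by rewrite inE connect0.
have tS : target e \notin S.
  rewrite inE; apply/negP => /connected_boundary[p pT pb].
  have pe : p e = 0 by apply: pT; rewrite !inE eqxx.
  have H : forall e', p e' - (e' == e)%:R = 0.
    apply: (acyclic_kernel acT) => [e' e'T|v].
      rewrite pT; last by rewrite !inE (negPf e'T) andbF.
      by case: eqP e'T => [->|]; rewrite ?eT ?subr0.
    rewrite /boundary; under eq_bigr do rewrite mulrBl.
    rewrite sumrB -/(boundary p v) pb (bigD1 e) //= eqxx mul1r big1 ?addr0 ?subrr //.
    by move=> e' /negPf ->; rewrite mul0r.
  by have := H e; rewrite pe eqxx.
have cross e' : e' \in T -> e' != e -> (source e' \in S) = (target e' \in S).
  move=> e'T ne; rewrite !inE.
  have adj : forall u v, joins e' u v -> adjacent (T :\ e) u v.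
    by move=> u v uv; apply/existsP; exists e'; rewrite !inE ne e'T.
  apply/idP/idP => H; apply: connect_trans H (connect1 _); apply: adj;
    by rewrite /joins !eqxx ?orbT.
clearbody S; exists S; split=> //.
have E1 : [set e' in T | target e' \in S] = inside T S.
  apply/setP => e'; rewrite !inE; case e'T : (e' \in T) => //=.
  have [->|ne] := eqVneq e' e; last by rewrite [X in _ = X && _]cross // andbb.
  by rewrite (negPf tS) andbF.
have S1 : S != set0 by apply/set0Pn; exists (source e).
have S2 : ~: S != set0 by apply/set0Pn; exists (target e); rewrite inE.
have I1 := acyclic_inside acT S1; have I2 := acyclic_inside acT S2.
have TE : T = e |: (inside T S :|: inside T (~: S)).
  apply/setP => e'; rewrite !inE; have [->|ne] := eqVneq e' e; first by rewrite eT.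
  case e'T : (e' \in T) => //=; rewrite (cross e') //.
  by case: (target e' \in S).
have := tree_card; have := cardsC S.
have : (#|e |: (inside T S :|: inside T (~: S))| <= 1 + (#|inside T S| + #|inside T (~: S)|))%N.
  rewrite cardsU1; apply: leq_add; first by case: (_ \notin _).
  by rewrite cardsU leq_subr.
rewrite -TE E1; move: I1 I2; clear.
by move: #|_| #|_| #|_| #|_| #|_| #|_| => a b c d t n; lia.
Qed.

End Tree.
End Trees.

(** * From spanning trees to optimal flows *)

Section Flows.
Variables (R : realType) (G : digraph) (rho : {ffun edge G -> R}).
Hypothesis loopless : forall e : edge G, source e != target e.
Hypothesis generic_rho : generic rho.
Local Notation V := (vert G).
Local Notation E := (edge G).
Local Notation n := #|vert G|.
Implicit Types (T F C : {set E}) (S : {set V}) (lam mu : E -> int).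

Definition weight lam : R := \sum_e (lam e)%:~R * rho e.

Definition ext_edges T : {set E} :=
  [set e | (e \notin T) &&
     `[< exists C, [/\ is_cycle C, C \subset e |: T & e \in pos_part rho C] >]].

Definition to_real lam : {ffun E -> R} := [ffun e => (lam e)%:~R].

Lemma boundary_dependence (lam : {ffun E -> R}) :
  \sum_e lam e *: incidence_col R e = 0 <-> forall v, boundary lam v = 0.
Proof.
have E1 v : (\sum_e lam e *: incidence_col R e) v = boundary lam v.
  rewrite sum_ffunE; apply: eq_bigr => e _; rewrite !ffunE.
  by rewrite /incidence /GRing.scale /=.
split=> [H v|H]; first by rewrite -E1 H ffunE.
by apply/ffunP => v; rewrite E1 H ffunE.
Qed.

Lemma boundary_to_real lam v : boundary (to_real lam) v = (boundary lam v)%:~R.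
Proof.
rewrite /boundary rmorph_sum; apply: eq_bigr => e _ /=.
rewrite ffunE rmorphM /incidence rmorphB /=.
by rewrite !rmorph_nat.
Qed.

Lemma dependence_to_real C lam : (forall v, boundary lam v = 0) ->
  (forall e, (lam e != 0) = (e \in C)) -> dependence C (to_real lam).
Proof.
move=> b0 lC; split=> [e|]; first by rewrite ffunE intr_eq0.
by apply/boundary_dependence => v; rewrite boundary_to_real b0.
Qed.

Lemma dot_to_real lam : dot (to_real lam) rho = weight lam.
Proof. by apply: eq_bigr => e _; rewrite ffunE. Qed.

(** Dependences on the fundamental cycle are proportional, so scaling by the value at [e] instead of
    by the pairing with [rho] turns external activity into the sign of [weight lam]. *)
Lemma fundamental_ext T e : spanning_tree T -> e \notin T -> exists lam,
  [/\ forall v, boundary lam v = 0, lam e = 1,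
      forall e', e' \notin e |: T -> lam e' = 0,
      forall e', `|lam e'| <= 1 &
      if e \in ext_edges T then 0 < weight lam else weight lam < 0].
Proof.
move=> tT eT; have [lam [lb le lout l1 cyc]] := fundamental_cycle loopless tT eT.
exists lam; split=> //.
have dep : dependence [set e' | lam e' != 0] (to_real lam).
  by apply: dependence_to_real => // e'; rewrite inE.
have := generic_rho cyc dep; rewrite dot_to_real => w0.
rewrite inE eT /=; case: asboolP => [[C [cC CT]]|H].
  rewrite inE => /andP[eC /asboolP[mu [[muC /boundary_dependence mub] dmu mue]]].
  have muE e' : mu e' = mu e * (lam e')%:~R.
    apply/eqP; rewrite -subr_eq0; apply/eqP.
    have acT : acyclic T by case: tT.
    apply: (acyclic_kernel loopless (F := T) (lam := fun e' => mu e' - mu e * (lam e')%:~R)) => //.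
      move=> e1 e1T; have [->|ne] := eqVneq e1 e; first by rewrite le mulr1 subrr.
      have e1o : e1 \notin e |: T by rewrite !inE negb_or ne.
      rewrite (lout e1) // mulr0 subr0; apply/eqP/negPn; rewrite muC.
      by apply: contra e1o; exact: (subsetP CT).
    move=> v; rewrite /boundary; under eq_bigr do rewrite mulrBl -mulrA.
    rewrite sumrB -mulr_sumr -/(boundary mu v) mub sub0r; apply/eqP.
    rewrite oppr_eq0 mulf_eq0; apply/orP; right; apply/eqP.
    transitivity (boundary (to_real lam) v); last by rewrite boundary_to_real lb.
    by apply: eq_bigr => e2 _; rewrite ffunE.
  have : dot mu rho = mu e * weight lam.
    by rewrite mulr_sumr; apply: eq_bigr => e' _; rewrite mulrA -muE.
  by move=> dE; rewrite dE pmulr_rgt0 in dmu.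
rewrite lt_neqAle w0 /= leNgt; apply/negP => wpos; apply: H.
exists [set e' | lam e' != 0]; split=> //.
  by apply/subsetP => e'; rewrite inE; apply: contraNT => /lout ->.
rewrite !inE le oner_eq0 /=; apply/asboolP; exists (to_real lam); split=> //.
  by rewrite dot_to_real.
by rewrite ffunE le ltr01.
Qed.

(** Defined for any [A] rather than for the active edges alone: sets [A] of prescribed size will
    show that no coefficient up to the degree vanishes. *)
Definition endpoint_vector T (A : {set E}) : {ffun V -> nat} := [ffun v =>
  (#|[set e in A | source e == v]| + #|[set e in ~: (T :|: A) | target e == v]|)%N].

Definition tree_vector T : {ffun V -> nat} := endpoint_vector T (ext_edges T).

(* The divergence of the flow that sends X e out of n units to the source of e
   and the remaining n - X e to its target. *)
Definition shares (X : E -> nat) (v : V) : int :=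
  \sum_e (X e)%:Z * incidence int e v + n%:Z * \sum_e (v == target e)%:R.

Definition feasible (q : {ffun V -> nat}) (X : E -> nat) : Prop :=
  (forall e, (X e <= n)%N) /\ forall v, shares X v = n%:Z * (q v)%:Z + n%:Z - 1.

Definition extremal T (X : E -> nat) : Prop :=
  (forall e, e \in ext_edges T -> X e = n) /\
  (forall e, e \notin T -> e \notin ext_edges T -> X e = 0%N).

Lemma shares_diff X X' v : boundary (fun e => (X' e)%:Z - (X e)%:Z) v = shares X' v - shares X v.
Proof.
rewrite /shares /boundary; under eq_bigr do rewrite mulrBl.
rewrite sumrB; ring.
Qed.

Lemma ext_edges_out T e : e \in ext_edges T -> e \notin T.
Proof. by rewrite inE => /andP[]. Qed.

(* The tree edge e carries n - #|S| units, S the side of its source. *)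
Lemma tree_flow T : spanning_tree T -> exists X : E -> nat,
  [/\ feasible (tree_vector T) X, extremal T X & forall e, e \in T -> (0 < X e < n)%N].
Proof.
move=> tT; have tc := tree_card loopless tT.
(* What the tree edges must still deliver, since the edges outside [T] contribute exactly [n] times
   the tree vector. *)
pose b v : int := n%:Z - 1 - n%:Z * \sum_(e in T) (v == target e)%:R.
have sb : \sum_v b v = 0.
  rewrite sumrB -mulr_sumr exchange_big /=.
  under [X in _ - _ * X]eq_bigr => e eT.
    rewrite (bigD1 (target e)) //= eqxx big1; last by move=> v /negPf ->.
    rewrite addr0; over.
  rewrite !sumr_const -[_ *+ #|V|]mulr_natr !natz.
  by rewrite -tc intS; ring.
have [lam lT lb] := tree_boundary tT sb.
have lamS e : e \in T -> exists2 s, (0 < s < n)%N & lam e = n%:Z - s%:Z.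
  move=> eT; have [S [sS tS cross cS]] := tree_cut loopless tT eT.
  exists #|S|.
    rewrite card_gt0; apply/andP; split; first by apply/set0Pn; exists (source e).
    rewrite -cardsT; apply: proper_card; rewrite properE subsetT /=.
    by apply/subsetPn; exists (target e); rewrite ?inE.
  have := cut_boundary S lam; rewrite [RHS](bigD1 e) //= sS (negPf tS) subr0 mulr1.
  rewrite [X in _ = _ + X]big1 ?addr0 => [<-|e' ne]; last first.
    have [e'T|/lT ->] := boolP (e' \in T); last by rewrite mul0r.
    by rewrite cross // subrr mulr0.
  rewrite (eq_bigr _ (fun v _ => lb v)) /b sumrB -mulr_sumr exchange_big /=.
  have -> : \sum_(e' in T) \sum_(v in S) (v == target e')%:R =
      #|[set e' in T | target e' \in S]|%:Z.
    rewrite -[RHS]natz -sum1_card natr_sum [RHS]big_mkcond [LHS]big_mkcond.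
    apply: eq_bigr => e' _; rewrite inE; case: (e' \in T) => //=.
    rewrite big_mkcond (bigD1 (target e')) //= eqxx big1 ?addr0; first by case: ifP.
    by move=> v /negPf ->; case: ifP.
  by rewrite sumr_const -mulr_natr natz -cS intS; ring.
pose X e : nat := if e \in T then absz (lam e) else if e \in ext_edges T then n else 0%N.
have XT e : e \in T -> (X e)%:Z = lam e.
  move=> eT; have [s s0 ls] := lamS e eT.
  by rewrite /X eT ls; lia.
have XTn e : e \in T -> (0 < X e < n)%N.
  move=> eT; have [s s0 ls] := lamS e eT; have := XT e eT; rewrite ls; lia.
have XO e : e \notin T -> (X e)%:Z = n%:Z * (e \in ext_edges T)%:R.
  by move=> /negPf eT; rewrite /X eT; case: ifP; rewrite ?mulr1 ?mulr0.
exists X; split=> //; last first.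
- split=> e; last by rewrite /X => /negPf -> /negPf ->.
  by move=> ee; rewrite /X (negPf (ext_edges_out ee)) ee.
split=> [e|v].
  have [/XTn /andP[_ /ltnW] //|eT] := boolP (e \in T).
  by rewrite /X (negPf eT); case: ifP.
have card_sum (A : {set E}) (p : pred E) : #|[set e in A | p e]|%:Z = \sum_e (e \in A)%:R * (p
  e)%:R.
  rewrite -[LHS]natz -sum1_card natr_sum big_mkcond; apply: eq_bigr => e _.
  by rewrite inE; case: (e \in A); case: (p e); rewrite ?mulr1 ?mulr0.
have lbv : \sum_e (if e \in T then (X e)%:Z else 0) * incidence int e v = b v.
  rewrite -lb; apply: eq_bigr => e _.
  by case: ifP => [/XT ->//|eT]; rewrite lT ?eT.
rewrite /tree_vector /endpoint_vector ffunE PoszD mulrDr !card_sum -addrA.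
have -> : n%:Z - 1 = b v + n%:Z * \sum_e (e \in T)%:R * (v == target e)%:R.
  rewrite /b [X in _ - _ * X]big_mkcond /=.
  have -> : \sum_e (if e \in T then (v == target e)%:R else 0) =
    \sum_e (e \in T)%:R * (v == target e)%:R :> int.
    by apply: eq_bigr => e _; case: ifP; rewrite ?mul1r ?mul0r.
  by rewrite subrK.
rewrite -addrA -lbv /shares !mulr_sumr -!big_split /=; apply: eq_bigr => e _.
rewrite !inE /incidence !(eq_sym _ v); case eT : (e \in T) => /=.
  by have := @ext_edges_out T e; rewrite eT inE /= => H; ring.
rewrite XO ?eT // inE eT /=; case: (`[< _ >]) => /=; ring.
Qed.

(** Fundamental cycles span the circulations: both sides agree off [T], and a circulation supported
    in [T] is 0. *)
Lemma tree_decomposition T (fam : E -> E -> int) mu : spanning_tree T ->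
  (forall e, e \notin T -> [/\ forall v, boundary (fam e) v = 0, fam e e = 1 &
     forall e', e' \notin e |: T -> fam e e' = 0]) ->
  (forall v, boundary mu v = 0) ->
  forall e', mu e' = \sum_(e | e \notin T) mu e * fam e e'.
Proof.
move=> tT famP mb e'; apply/eqP; rewrite -subr_eq0; apply/eqP.
have acT : acyclic T by case: tT.
apply: (acyclic_kernel loopless (F := T)
  (lam := fun e' => mu e' - \sum_(e | e \notin T) mu e * fam e e')) => //.
  move=> e1 e1T; rewrite (bigD1 e1) //= big1 => [|e /andP[eT ee1]].
    by have [_ -> _] := famP e1 e1T; rewrite mulr1 addr0 subrr.
  have [_ _ ->] := famP e eT; rewrite ?mulr0 // !inE negb_or e1T andbT.
  by rewrite eq_sym.
move=> v; rewrite /boundary; under eq_bigr do rewrite mulrBl mulr_suml.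
rewrite sumrB -/(boundary mu v) mb exchange_big /= big1 ?subr0 // => e eT.
have [be _ _] := famP e eT; rewrite -[RHS](mulr0 (mu e)) -[in RHS](be v) mulr_sumr.
by apply: eq_bigr => e1 _; rewrite mulrA.
Qed.

(** The simplex optimality criterion. The change of flow is a combination of fundamental cycles:
    active edges are full and can only decrease along a cycle of positive weight, the others are
    empty and can only increase along one of negative weight. *)
Lemma extremal_optimal T X X' : spanning_tree T -> extremal T X ->
  (forall e, (X e <= n)%N) -> (forall e, (X' e <= n)%N) ->
  (forall v, shares X' v = shares X v) ->
  let mu := fun e => (X' e)%:Z - (X e)%:Z in
  weight mu <= 0 /\ (weight mu = 0 -> forall e, mu e = 0).
Proof.
move=> tT [Xe X0] Xn X'n same mu.
pose good e lam := e \notin T -> [/\ forall v, boundary lam v = 0, lam e = 1,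
      forall e', e' \notin e |: T -> lam e' = 0,
      forall e', `|lam e'| <= 1 &
      if e \in ext_edges T then 0 < weight lam else weight lam < 0].
have /(@choice _ _ good)[fam famP] : forall e, exists lam, good e lam.
  move=> e; have [eT|eT] := boolP (e \in T).
    by exists (fun=> 0); rewrite /good eT.
  by have [lam H] := fundamental_ext tT eT; exists lam.
have mb v : boundary mu v = 0 by rewrite /mu shares_diff same subrr.
have famP' e : e \notin T -> [/\ forall v, boundary (fam e) v = 0, fam e e = 1 &
     forall e', e' \notin e |: T -> fam e e' = 0].
  by move=> eT; have [? ? ? _ _] := famP e eT.
have dec := tree_decomposition tT famP' mb.
have wE : weight mu = \sum_(e | e \notin T) (mu e)%:~R * weight (fam e).
  rewrite /weight.
  under eq_bigr do rewrite {1}dec rmorph_sum mulr_suml.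
  rewrite exchange_big; apply: eq_bigr => e _; rewrite mulr_sumr.
  by apply: eq_bigr => e' _; rewrite rmorphM mulrA.
have term e : e \notin T -> (mu e)%:~R * weight (fam e) <= 0 :> R.
  move=> eT; have [_ _ _ _] := famP e eT; case: ifP => [ee|/negbT ee] w.
    rewrite mulr_le0_ge0 ?(ltW w) // lerz0 /mu Xe //.
    by have := X'n e; lia.
  by rewrite mulr_ge0_le0 ?(ltW w) // ler0z /mu X0.
split; first by rewrite wE; apply: sumr_le0.
rewrite wE => /eqP; rewrite -oppr_eq0 -sumrN psumr_eq0 => [/allP H|e eT]; last first.
  by rewrite oppr_ge0 term.
have muT e : e \notin T -> mu e = 0.
  move=> eT; have := H e; rewrite mem_index_enum eT => /(_ isT) /=.
  rewrite oppr_eq0 mulf_eq0 intr_eq0 => /orP[/eqP //|].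
  by have [_ _ _ _] := famP e eT; case: ifP => _ w; rewrite ?(gt_eqF w) ?(lt_eqF w).
by move=> e; rewrite dec big1 // => e' /muT ->; rewrite mul0r.
Qed.

(** Each tree flow is the unique optimum for its vector, so equal vectors give equal flows, and the
    tree is read off as the set of fractional edges. *)
Lemma tree_vector_inj T T' : spanning_tree T -> spanning_tree T' ->
  tree_vector T = tree_vector T' -> T = T'.
Proof.
move=> tT tT' eq.
have [X [[Xn Xs] Xx XT]] := tree_flow tT.
have [X' [[Xn' Xs'] Xx' XT']] := tree_flow tT'.
have same v : shares X' v = shares X v by rewrite Xs Xs' eq.
have [le1 _] := extremal_optimal tT' Xx' Xn' Xn (fun v => esym (same v)).
have [le2 H] := extremal_optimal tT Xx Xn Xn' same.
have w0 : weight (fun e => (X' e)%:Z - (X e)%:Z) = 0.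
  apply/eqP; rewrite eq_le le2 /= -oppr_le0 (le_trans _ le1) // le_eqVlt.
  apply/orP; left; apply/eqP; rewrite /weight -sumrN; apply: eq_bigr => e _.
  by rewrite -mulNr -rmorphN opprB.
have XX e : X e = X' e.
  by have := H w0 e => /eqP; rewrite subr_eq0 => /eqP [].
apply/setP => e; apply/idP/idP => eT.
  apply: contraT => eT'; have := XT e eT; rewrite XX.
  have [ee|ee] := boolP (e \in ext_edges T'); first by rewrite (proj1 Xx') // ltnn andbF.
  by rewrite (proj2 Xx').
apply: contraT => eT'; have := XT' e eT; rewrite -XX.
have [ee|ee] := boolP (e \in ext_edges T); first by rewrite (proj1 Xx) // ltnn andbF.
by rewrite (proj2 Xx).
Qed.

End Flows.

(** * From optimal flows back to spanning trees *)

Section Surjectivity.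
Variables (R : realType) (G : digraph) (rho : {ffun edge G -> R}).
Hypothesis loopless : forall e : edge G, source e != target e.
Hypothesis generic_rho : generic rho.
Hypothesis V0 : (0 < #|vert G|)%N.
Local Notation V := (vert G).
Local Notation E := (edge G).
Local Notation n := #|vert G|.
Local Notation weight := (weight rho).
Implicit Types (T F C : {set E}) (S : {set V}) (lam mu : E -> int).

Definition optimal q (X : E -> nat) : Prop :=
  feasible q X /\ forall X', feasible q X' -> weight (fun e => (X' e)%:Z) <= weight (fun e => (X
    e)%:Z).

Lemma optimal_exists q X0 : feasible q X0 -> exists X : E -> nat, optimal q X.
Proof.
pose val_of (Y : {ffun E -> 'I_n.+1}) e : nat := Y e.
pose P (Y : {ffun E -> 'I_n.+1}) := `[< feasible q (val_of Y) >].
have repr X : feasible q X -> exists2 Y, P Y & forall e, val_of Y e = X e.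
  move=> fX; exists [ffun e => inord (X e)].
    apply/asboolP; split=> [e|v]; first by rewrite /val_of -ltnS ltn_ord.
    case: fX => Xn <-; congr (_ + _); apply: eq_bigr => e _.
    by rewrite /val_of ffunE inordK // ltnS.
  by case: fX => Xn _ e; rewrite /val_of ffunE inordK // ltnS.
move=> /repr[Y0 PY0 _].
have := @arg_maxP _ R _ Y0 P (fun Y => weight (fun e => (val_of Y e)%:Z)) PY0.
case=> Y /asboolP fY Ymax; exists (val_of Y); split=> // X' /repr[Y' PY' YX'].
have -> : weight (fun e => (X' e)%:Z) = weight (fun e => (val_of Y' e)%:Z).
  by apply: eq_bigr => e _; rewrite YX'.
exact: Ymax.
Qed.

Lemma optimal_shift q X lam : optimal q X -> (forall v, boundary lam v = 0) ->
  (forall e, `|lam e| <= 1) -> (forall e, lam e = 1 -> (X e < n)%N) ->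
  (forall e, lam e = -1 -> (0 < X e)%N) -> weight lam <= 0.
Proof.
move=> [[Xn Xs] Xmax] lb l1 lp lm.
pose X' e := absz ((X e)%:Z + lam e).
have bound e : 0 <= (X e)%:Z + lam e <= n%:Z.
  have [e1|e1] := eqVneq (lam e) 1; first by have := lp e e1; rewrite e1; lia.
  have [em|em] := eqVneq (lam e) (-1); first by have := lm e em; have := Xn e; rewrite em; lia.
  by have := l1 e; have := Xn e; lia.
have X'E e : (X' e)%:Z = (X e)%:Z + lam e by have := bound e; rewrite /X'; lia.
have fX' : feasible q X'.
  split=> [e|v]; first by have := bound e; have := X'E e; lia.
  rewrite -Xs; apply/eqP; rewrite -subr_eq0 -shares_diff; apply/eqP.
  by rewrite -[RHS](lb v); apply: eq_bigr => e _; rewrite X'E addrC addKr.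
have := Xmax X' fX'.
have -> : weight (fun e => (X' e)%:Z) = weight (fun e => (X e)%:Z) + weight lam.
  by rewrite -big_split; apply: eq_bigr => e _; rewrite X'E rmorphD mulrDl.
by rewrite gerDl.
Qed.

Lemma weightN lam : weight (fun e => - lam e) = - weight lam.
Proof. by rewrite -sumrN; apply: eq_bigr => e _; rewrite rmorphN mulNr. Qed.

Lemma boundaryN lam v : boundary (fun e => - lam e) v = - boundary lam v.
Proof. by rewrite -sumrN; apply: eq_bigr => e _; rewrite mulNr. Qed.

Section Fractional.
Variables (q : {ffun V -> nat}) (X : E -> nat).
Hypothesis X_opt : optimal q X.

Let T := [set e | (0 < X e < n)%N].

Let Xn e : (X e <= n)%N. Proof. by case: X_opt => [[]]. Qed.

Let X_out e : e \notin T -> X e = 0%N \/ X e = n.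
Proof.
rewrite inE negb_and -leqNgt leqn0 -leqNgt => /orP[/eqP ->|nX]; first by left.
by right; apply/eqP; rewrite eqn_leq Xn.
Qed.

Let shift lam : (forall v, boundary lam v = 0) -> (forall e, `|lam e| <= 1) ->
  (forall e, e \notin T -> lam e = 1 -> X e = 0%N) ->
  (forall e, e \notin T -> lam e = -1 -> X e = n) -> weight lam <= 0.
Proof.
move=> lb l1 lp lm; apply: (optimal_shift X_opt) => // e le.
  have [|eT] := boolP (e \in T); first by rewrite inE => /andP[].
  by rewrite lp.
have [|eT] := boolP (e \in T); first by rewrite inE => /andP[].
by rewrite lm.
Qed.

(** A cycle of fractional edges could be pushed by one unit in both directions, so optimality would
    make its weight 0, against genericity. *)
Lemma fractional_acyclic : acyclic T.
Proof.
move=> C cC; apply/negP => CT.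
have [lam [lb lC lout]] := cycle_dependence cC.
have l1 e : `|lam e| <= 1 by have [/lC ->|/lout ->] := boolP (e \in C); rewrite ?normr0.
have l0 e : e \notin T -> lam e = 0 by move=> eT; apply: lout; apply: contra eT; exact: (subsetP
  CT).
have le1 : weight lam <= 0 by apply: shift => // e /l0 ->.
have le2 : weight (fun e => - lam e) <= 0.
  apply: shift => [v|e|e /l0 ->|e /l0 ->] //; first by rewrite boundaryN lb oppr0.
  by rewrite normrN.
have dep : dependence C (to_real R lam).
  apply: dependence_to_real => // e; apply/idP/idP => [|/lC le].
    by apply: contraNT => /lout ->.
  by apply/eqP => l00; rewrite l00 normr0 in le.
have := generic_rho cC dep; rewrite dot_to_real.
by rewrite weightN oppr_le0 in le2; rewrite eq_le le1 le2.
Qed.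

(** Across a cut free of fractional edges the total share of [S] is a multiple of [n], whereas the
    demand is [-|S|] modulo [n] with 0 < |S| < [n]. *)
Lemma fractional_connected : connected_by T.
Proof.
split=> // u v; apply: contraT => nuv.
pose S := [set x | connect (adjacent T) u x].
have uS : u \in S by rewrite inE connect0.
have vS : v \notin S by rewrite inE.
have cross e : e \in T -> (source e \in S) = (target e \in S).
  move=> eT; rewrite !inE.
  have adj : forall x y, joins e x y -> adjacent T x y.
    by move=> x y xy; apply/existsP; exists e; rewrite eT.
  by apply/idP/idP => H; apply: connect_trans H (connect1 _); apply: adj;
    rewrite /joins !eqxx ?orbT.
have S_lt : (0 < #|S| < n)%N.
  apply/andP; split; first by apply/card_gt0P; exists u.
  by rewrite -cardsT; apply: proper_card; rewrite properE subsetT; apply/subsetPn; exists v.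
have [[_ Xs] _] := X_opt.
have E1 : \sum_(x in S) shares X x = n%:Z * (\sum_(x in S) (q x)%:Z) + #|S|%:Z * (n%:Z - 1).
  rewrite (eq_bigr _ (fun x _ => Xs x)) mulr_sumr.
  under eq_bigr do rewrite -addrA.
  by rewrite big_split /= sumr_const -[_ *+ #|S|]mulr_natl natz.
have [k E2] : exists k, \sum_(x in S) shares X x = n%:Z * k.
  pose d e : int := (source e \in S)%:R - (target e \in S)%:R.
  exists (\sum_e (if X e == n then d e else 0) + \sum_(x in S) \sum_e (x == target e)%:R).
  rewrite big_split /= -mulr_sumr mulrDr; congr (_ + _).
  rewrite -[LHS]/(\sum_(x in S) boundary (fun e => (X e)%:Z) x) cut_boundary mulr_sumr.
  apply: eq_bigr => e _; rewrite -/(d e).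
  have [eT|/X_out[->|->]] := boolP (e \in T).
  - rewrite /d cross // subrr mulr0; case: ifP; by rewrite mulr0.
  - by rewrite eq_sym gtn_eqF // mul0r mulr0.
  - by rewrite eqxx.
have : #|S|%:Z = n%:Z * (\sum_(x in S) (q x)%:Z + #|S|%:Z - k).
  by rewrite mulrBr -E2 E1; ring.
move: (_ - k) S_lt; clear => m; move: #|S| #|V| => s t /andP[s0 st] E.
have : 0 < m by have : 0 < t%:Z * m; [rewrite -E; lia | nia].
by nia.
Qed.

Lemma fractional_tree : spanning_tree T.
Proof. by split; [exact: fractional_connected | exact: fractional_acyclic]. Qed.

(** An edge outside [T] at the wrong bound would allow a unit push along its fundamental cycle, in
    the direction that increases the weight. *)
Lemma fractional_extremal : extremal rho T X.
Proof.
split=> e.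
  move=> ee; have eT := ext_edges_out ee.
  have [X0|//] := X_out eT.
  have [lam [lb le lout l1]] := fundamental_ext loopless generic_rho fractional_tree eT.
  rewrite ee ltNge => /negP[]; apply: shift => // e' e'T l'.
    have [->//|ne] := eqVneq e' e.
    by have := lout e'; rewrite in_setU1 negb_or ne e'T l' => /(_ isT).
  have [ee'|ne] := eqVneq e' e; first by rewrite ee' le in l'.
  by have := lout e'; rewrite in_setU1 negb_or ne e'T l' => /(_ isT).
move=> eT ee; have [//|Xen] := X_out eT.
have [lam [lb le lout l1]] := fundamental_ext loopless generic_rho fractional_tree eT.
rewrite (negPf ee) -oppr_gt0 -weightN ltNge => /negP[]; apply: shift.
- by move=> v; rewrite boundaryN lb oppr0.
- by move=> e'; rewrite normrN.
- move=> e' e'T l'; have [ee'|ne] := eqVneq e' e; first by rewrite ee' le in l'.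
  have := lout e'; rewrite in_setU1 negb_or ne e'T => /(_ isT) l0.
  by rewrite l0 in l'.
- move=> e' e'T l'; have [-> //|ne] := eqVneq e' e.
  have := lout e'; rewrite in_setU1 negb_or ne e'T => /(_ isT) l0.
  by rewrite l0 in l'.
Qed.

(** Compare [X] with the flow [Y] built from the tree. They agree off [T], and on a tree edge the
    fundamental cut makes the difference a multiple of [n], hence 0, as both values lie strictly
    between 0 and [n]. *)
Lemma fractional_tree_vector : tree_vector rho T = q.
Proof.
have tT := fractional_tree.
have [Y [[Yn Ys] [Ye Y0] YT]] := tree_flow rho loopless tT.
have [Xe X0] := fractional_extremal; have [[_ Xs] _] := X_opt.
pose mu e := (X e)%:Z - (Y e)%:Z.
have mu_out e : e \notin T -> mu e = 0.
  move=> eT; rewrite /mu; have [ee|ee] := boolP (e \in ext_edges rho T).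
    by rewrite Xe // Ye // subrr.
  by rewrite X0 // Y0 // subrr.
have mub v : boundary mu v = n%:Z * ((q v)%:Z - (tree_vector rho T v)%:Z).
  by rewrite /mu shares_diff Xs Ys; ring.
have mu0 e : mu e = 0.
  have [eT|/mu_out //] := boolP (e \in T).
  have [S [sS tS cross _]] := tree_cut loopless tT eT.
  have := cut_boundary S mu; rewrite [RHS](bigD1 e) //= sS (negPf tS) subr0 mulr1.
  rewrite [X in _ = _ + X]big1 ?addr0 => [|e' ne]; last first.
    have [e'T|/mu_out ->] := boolP (e' \in T); last by rewrite mul0r.
    by rewrite cross // subrr mulr0.
  rewrite (eq_bigr _ (fun v _ => mub v)) -mulr_sumr.
  have := YT e eT; have : (0 < X e < n)%N by move: eT; rewrite inE.
  rewrite /mu; move: (\sum_(i in S) _) (X e) (Y e) #|V|; clear => k x y t Hx Hy E.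
  by have [k0|k0|k0] := ltrgtP k 0; [nia | nia | rewrite k0 in E; lia].
apply/ffunP => v; have := mub v.
rewrite /boundary big1 => [|e _]; last by rewrite mu0 mul0r.
move/esym/eqP; rewrite mulf_eq0 => /orP[/eqP n0|].
  by have := V0; rewrite (_ : n = 0%N) // ; case: n0.
by rewrite subr_eq0 => /eqP [].
Qed.

End Fractional.

Lemma tree_vector_surj q X : feasible q X ->
  exists2 T, spanning_tree T & tree_vector rho T = q.
Proof.
move=> /optimal_exists[Y Yopt].
by exists [set e | (0 < Y e < n)%N]; [exact: fractional_tree Yopt | exact: fractional_tree_vector].
Qed.

End Surjectivity.

(** * Break vectors *)

Section BreakVectors.
Variable G : digraph.
Hypothesis loopless : forall e : edge G, source e != target e.
Local Notation V := (vert G).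
Local Notation E := (edge G).
Local Notation vec := {ffun vert G -> nat}.
Implicit Types (T F : {set E}) (S : {set V}) (q : vec).

Definition touch S (e : E) : bool := (source e \in S) || (target e \in S).

Definition touching F S : nat := (\sum_(e in F) touch S e)%N.

(** The defect at the single edge [e] is kept, because it pays for the [n] units of [e] when a lower
    and an upper bound on its share are compared. *)
Lemma touching_submodular F S1 S2 e : e \in F ->
  (touching F (S1 :|: S2) + touching F (S1 :&: S2) +
     [&& touch S1 e, touch S2 e & ~~ touch (S1 :&: S2) e] <= touching F S1 + touching F S2)%N.
Proof.
move=> eF; rewrite /touching !(bigD1 e eF) /=.
have : (\sum_(e' in F | e' != e) touch (S1 :|: S2) e' +
        \sum_(e' in F | e' != e) touch (S1 :&: S2) e' <=
        \sum_(e' in F | e' != e) touch S1 e' + \sum_(e' in F | e' != e) touch S2 e')%N.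
  rewrite -!big_split /=; apply: leq_sum => e' _; rewrite /touch !inE.
  by case: (source e' \in S1); case: (source e' \in S2); case: (target e' \in S1);
    case: (target e' \in S2).
have : (touch (S1 :|: S2) e + touch (S1 :&: S2) e +
   [&& touch S1 e, touch S2 e & ~~ touch (S1 :&: S2) e] <= touch S1 e + touch S2 e)%N.
  rewrite /touch !inE.
  by case: (source e \in S1); case: (source e \in S2); case: (target e \in S1);
    case: (target e \in S2).
move: (\sum_(_ in _ | _) _)%N (\sum_(_ in _ | _) _)%N (\sum_(_ in _ | _) _)%N (\sum_(_ in _ | _)
  _)%N.
move: (nat_of_bool _) (nat_of_bool _) (nat_of_bool _) (nat_of_bool _) (nat_of_bool _).
by clear; lia.
Qed.

Lemma touching_set0 F : touching F set0 = 0%N.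
Proof. by apply: big1 => e _; rewrite /touch !inE. Qed.

Lemma sum_setUI (b : V -> int) S1 S2 :
  \sum_(v in S1) b v + \sum_(v in S2) b v =
  \sum_(v in S1 :|: S2) b v + \sum_(v in S1 :&: S2) b v.
Proof.
rewrite [X in X + _]big_mkcond [X in _ + X = _]big_mkcond /=.
rewrite [X in _ = X + _]big_mkcond [X in _ = _ + X]big_mkcond /=.
rewrite -!big_split; apply: eq_bigr => v _ /=; rewrite !inE.
by case: (v \in S1); case: (v \in S2); rewrite ?addr0 ?add0r.
Qed.

(* Removing one edge, the admissible shares of its source form an interval,
   which submodularity of [touching] makes nonempty. *)
Lemma shares_exist (n : nat) F (b : V -> int) :
  (forall S, \sum_(v in S) b v <= n%:Z * (touching F S)%:Z) ->
  \sum_v b v = n%:Z * #|F|%:Z ->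
  exists X : E -> nat, (forall e, (X e <= n)%N) /\
    forall v, \sum_(e in F) ((X e)%:Z * (v == source e)%:R + (n%:Z - (X e)%:Z) * (v == target
      e)%:R) = b v.
Proof.
elim: {F}#|F| {-2}F (erefl #|F|) b => [|m IH] F Fm b bS bV.
  move/cards0_eq: Fm bS bV => -> bS; rewrite cards0 mulr0 => bV.
  exists (fun=> 0%N); split=> // v; rewrite big_set0.
  have b_le0 u : b u <= 0.
    have := bS [set u]; rewrite big_set1 => /le_trans; apply.
    by rewrite /touching big_set0 mulr0.
  move/eqP: bV; rewrite -oppr_eq0 -sumrN psumr_eq0 => [/allP/(_ v)|u _]; last by rewrite oppr_ge0.
  by rewrite mem_index_enum oppr_eq0 => /(_ isT)/eqP.
have /card_gt0P[e eF] : (0 < #|F|)%N by rewrite Fm.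
have F'm : #|F :\ e| = m by have := cardsD1 e F; rewrite eF Fm; case.
have tF S : touching F S = (touch S e + touching (F :\ e) S)%N by rewrite /touching (big_setD1 e).
pose P S := (source e \in S) && (target e \notin S).
(* The share of [e] that [S] forces at the source: its demand beyond the capacity of the other
   edges. The added [n] takes back the contribution of [e] to [touching F S]. *)
pose L S : int := \sum_(v in S) b v - n%:Z * (touching F S)%:Z + n%:Z.
have P1 : P [set source e] by rewrite /P !inE eqxx eq_sym loopless.
have := @arg_maxP _ _ _ [set source e] P L P1.
case=> S0 /andP[S0s S0t] S0max.
pose a : int := Num.max 0 (L S0).
have a0 : 0 <= a by rewrite le_max lexx.
have aL S : P S -> L S <= a by move=> /S0max /= H; rewrite le_max H orbT.
have an : a <= n%:Z.
  by rewrite ge_max lez_nat /=; have := bS S0; rewrite /L; lia.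
have aU S : source e \notin S -> target e \in S ->
    a <= n%:Z * (touching F S)%:Z - \sum_(v in S) b v.
  move=> sS tS; rewrite ge_max subr_ge0 bS /=.
  have := touching_submodular S0 S eF.
  rewrite /touch !inE S0s tS (negPf sS) (negPf S0t) ?andbF /= ?orbT /=.
  have := bS (S0 :|: S); have := bS (S0 :&: S); have := sum_setUI b S0 S.
  rewrite /L; move: (touching F _) (touching F _) (touching F _) (touching F _).
  move=> t1 t2 t3 t4; move: (\sum_(v in _) _) (\sum_(v in _) _) (\sum_(v in _) _) (\sum_(v in _) _).
  by move=> s1 s2 s3 s4; clear; nia.
pose b' v := b v - a * (v == source e)%:R - (n%:Z - a) * (v == target e)%:R.
have b'S S : \sum_(v in S) b' v = \sum_(v in S) b v - a * (source e \in S)%:R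
    - (n%:Z - a) * (target e \in S)%:R.
  have ind x : \sum_(v in S) (v == x)%:R = (x \in S)%:R :> int.
    rewrite big_mkcond (bigD1 x) //= eqxx big1 ?addr0; first by case: (x \in S).
    by move=> v /negPf ->; case: ifP.
  by rewrite !sumrB -!mulr_sumr !ind.
have [S||X [Xn Xb]] := IH (F :\ e) F'm b'.
- rewrite b'S; have := bS S; have := aL S; have := aU S; rewrite /P /L !tF /touch.
  case: (source e \in S); case: (target e \in S) => /= H1 H2 H3.
  + by lia.
  + by have := H2 isT; lia.
  + by have := H1 isT isT; lia.
  + by lia.
- have := b'S setT; rewrite !inE !mulr1.
  rewrite (eq_bigl xpredT) => [|v]; last by rewrite inE.
  move=> ->; rewrite (eq_bigl xpredT) => [|v]; last by rewrite inE.
  by rewrite bV F'm Fm intS; ring.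
exists (fun e' => if e' == e then absz a else X e'); split=> [e'|v].
  by case: eqP => // _; lia.
rewrite (big_setD1 e) //= eqxx gez0_abs //.
rewrite (eq_bigr (fun e' => (X e')%:Z * (v == source e')%:R + (n%:Z - (X e')%:Z) * (v == target
  e')%:R)).
  by rewrite Xb /b'; ring.
by move=> e' /setD1P[/negPf -> _].
Qed.

Definition break_vector q : bool :=
  (\sum_v q v + #|V| == #|E|.+1)%N &&
  [forall S : {set V}, (S != set0) ==> (S != setT) ==>
     (\sum_(v in S) q v + #|S| <= touching setT S)%N].

Lemma break_vectorP q : reflect
  ((\sum_v q v + #|V| = #|E|.+1)%N /\
   forall S, S != setT -> (\sum_(v in S) q v + #|S| <= touching setT S)%N)
  (break_vector q).
Proof.
apply: (iffP andP) => [[/eqP sq /forallP H]|[/eqP sq H]]; split=> //.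
  move=> S ST; have [->|S0] := eqVneq S set0; first by rewrite big_set0 cards0.
  by have := H S; rewrite S0 ST.
by apply/forallP => S; apply/implyP => _; apply/implyP; exact: H.
Qed.

(** For proper [S] the demand is at most [n (q(S) + |S|)]. For the whole vertex set, [q(V) + |V|]
    exceeds [|E|] by one, and the units subtracted at the [n] vertices compensate exactly. *)
Lemma break_vector_feasible q : break_vector q -> exists X, feasible q X.
Proof.
move=> /break_vectorP[sq qS].
have EE : #|E|%:Z = (\sum_v q v)%N%:Z + #|V|%:Z - 1 by move: sq; clear; lia.
have [||X [Xn Xb]] := @shares_exist #|V| setT (fun v => #|V|%:Z * (q v)%:Z + #|V|%:Z - 1).
- move=> S; rewrite sumrB big_split /= -mulr_sumr !sumr_const -[_%:Z *+ _]mulr_natr natz.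
  have -> : \sum_(v in S) (q v)%:Z = (\sum_(v in S) q v)%N%:Z.
    by rewrite (big_morph Posz PoszD (erefl _)).
  have [->|ST] := eqVneq S setT; last by have := qS S ST; rewrite ?natz; nia.
  have -> : (\sum_(v in [set: V]) q v = \sum_v q v)%N by apply: eq_bigl => v; rewrite inE.
  have -> : touching [set: E] [set: V] = #|E|.
    rewrite /touching -sum1_card; apply: eq_big => [e|e _]; first by rewrite inE.
    by rewrite /touch inE.
  by rewrite cardsT ?natz EE le_eqVlt; apply/orP; left; apply/eqP; ring.
- rewrite sumrB big_split /= -mulr_sumr !sumr_const -[_%:Z *+ _]mulr_natr natz cardsT.
  have -> : \sum_v (q v)%:Z = (\sum_v q v)%N%:Z.
    by rewrite (big_morph Posz PoszD (erefl _)).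
  by rewrite ?natz EE; ring.
exists X; split=> // v; rewrite -Xb /shares mulr_sumr -big_split /=.
rewrite [RHS](eq_bigl xpredT) => [|e]; last by rewrite inE.
by apply: eq_bigr => e _; rewrite /incidence; ring.
Qed.

Lemma endpoint_sum T (A : {set E}) S : [disjoint T & A] ->
  (\sum_(v in S) endpoint_vector T A v =
    \sum_(e in ~: T) (if e \in A then source e \in S else target e \in S))%N.
Proof.
move=> TA; under eq_bigr do rewrite ffunE.
have cnt (B : {set E}) (f : E -> V) :
    (\sum_(v in S) #|[set e in B | f e == v]| = \sum_(e in B) (f e \in S))%N.
  under eq_bigr do rewrite -sum1dep_card.
  rewrite [RHS]big_mkcond /=.
  under eq_bigr do rewrite big_mkcond /=.
  rewrite exchange_big /=; apply: eq_bigr => e _.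
  case eB : (e \in B) => /=; last by rewrite big1.
  rewrite big_mkcond (bigD1 (f e)) //= eqxx big1 ?addn0; first by case: (f e \in S).
  by move=> v /negPf; rewrite eq_sym => ->; case: ifP.
rewrite big_split /= !cnt !(big_mkcond (fun e => e \in _)) /= -big_split; apply: eq_bigr => e _ /=.
rewrite !inE; case eA : (e \in A); case eT : (e \in T) => //=; rewrite ?addn0 //.
by have /disjointFr/(_ eT) := TA; rewrite eA.
Qed.

(** An edge outside [T] counted in [S] touches [S]. Of the [|V| - 1] tree edges at most
    [|V| - |S| - 1] avoid [S], so at least [|S|] touch it. *)
Lemma endpoint_break T (A : {set E}) : spanning_tree T -> [disjoint T & A] ->
  break_vector (endpoint_vector T A).
Proof.
move=> tT TA; have tc := tree_card loopless tT.
have sT : (\sum_v endpoint_vector T A v = #|~: T|)%N.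
  have := endpoint_sum setT TA.
  rewrite (eq_bigl xpredT) => [->|v]; last by rewrite inE.
  by rewrite -sum1_card; apply: eq_bigr => e _; rewrite !inE; case: ifP.
apply/break_vectorP; split=> [|S ST].
  by rewrite sT -tc; have := cardsC T; lia.
rewrite endpoint_sum // /touching.
have -> : (\sum_(e in [set: E]) touch S e =
    \sum_(e in ~: T) touch S e + \sum_(e in T) touch S e)%N.
  rewrite addnC (bigID (mem T)) /=; congr (_ + _)%N; apply: eq_bigl => e; rewrite !inE //.
apply: leq_add; first by apply: leq_sum => e _; rewrite /touch; case: ifP; case: (_ \in S) => //;
  rewrite ?orbT.
have S0 : ~: S != set0 by apply: contraNneq ST => SC; rewrite -[S]setCK SC setC0.
have acT : acyclic T by case: tT.
have := acyclic_inside loopless acT S0.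
have : (#|T| = \sum_(e in T) touch S e + #|inside T (~: S)|)%N.
  rewrite -!sum1_card [X in (_ = _ + X)%N]big_mkcond /= [LHS]big_mkcond [X in (_ = X +
    _)%N]big_mkcond.
  rewrite -big_split; apply: eq_bigr => e _ /=; rewrite !inE /touch.
  by case: (e \in T); case: (source e \in S); case: (target e \in S).
by have := cardsC S; lia.
Qed.

Definition break_list : seq vec :=
  [seq q <- [seq [ffun v => nat_of_ord (f v)] | f : {ffun V -> 'I_#|E|.+2}] | break_vector q].

Lemma mem_break_list q : (q \in break_list) = break_vector q.
Proof.
rewrite mem_filter andbC; case bq : (break_vector q); rewrite ?andbF // andbT.
have /break_vectorP[sq _] := bq.
have q_lt v : (q v < #|E|.+2)%N.
  by move: sq; rewrite (bigD1 v) //=; lia.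
apply/imageP; exists [ffun v => Ordinal (q_lt v)] => //.
by apply/ffunP => v; rewrite !ffunE.
Qed.

Lemma sum_add1_sub1 (q : vec) (S : {set V}) u v : (0 < q u)%N ->
  (\sum_(x in S) (q x - (x == u) + (x == v)) + (u \in S) = \sum_(x in S) q x + (v \in S))%N.
Proof.
move=> qu.
have ind y : (\sum_(x in S) (x == y) = (y \in S))%N.
  rewrite big_mkcond (bigD1 y) //= eqxx big1 ?addn0; first by case: (y \in S).
  by move=> x /negPf ->; case: ifP.
rewrite big_split /= (ind v) addnAC; congr (_ + _)%N; rewrite -(ind u) -big_split /=.
by apply: eq_bigr => x _; rewrite subnK //; have [->|] := eqVneq x u.
Qed.

(* A unit can move from u to v unless some tight set contains v but not u; the
   union of the tight sets avoiding u is again tight. *)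
Lemma break_exchange : exchangeable break_list.
Proof.
move=> q q' u; rewrite !mem_break_list => /break_vectorP[sq qS] /break_vectorP[sq' qS'] qu.
pose tight S := (u \notin S) && (\sum_(v in S) q v + #|S| == touching setT S)%N.
have t0 : tight set0 by rewrite /tight inE big_set0 cards0 touching_set0.
have [M /andP[uM /eqP tM] Mmax] := @arg_maxnP _ set0 tight (fun S => #|S|) t0.
have MT : M != setT by apply: contraNneq uM => ->; rewrite inE.
have q_sub (S : {set V}) : u \in S -> (forall v, v \in S -> v != u -> (q' v <= q v)%N) ->
    (\sum_(v in S) q' v < \sum_(v in S) q v)%N.
  move=> uS H; rewrite (bigD1 u) //= [X in (_ < X)%N](bigD1 u) //=.
  rewrite -addSn; apply: leq_add => //; apply: leq_sum => v /andP[vS vu]; exact: H.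
have [/existsP[v /andP[vM qv]]|/existsPn H] := boolP [exists v, (v \notin M) && (q v < q' v)%N].
  exists v => //; rewrite mem_break_list; apply/break_vectorP.
  have qu0 : (0 < q u)%N by exact: leq_ltn_trans qu.
  split.
    have sumT (f : V -> nat) : (\sum_(x in [set: V]) f x = \sum_x f x)%N.
      by apply: eq_bigl => x; rewrite inE.
    have := sum_add1_sub1 setT v qu0; rewrite !inE !sumT => E1.
    under eq_bigr do rewrite ffunE.
    by rewrite -sq; congr (_ + _)%N; apply: (@addIn 1).
  move=> S ST; have := sum_add1_sub1 S v qu0; have := qS S ST.
  under [X in _ -> _ -> (X + _ <= _)%N]eq_bigr do rewrite ffunE.
  case vS : (v \in S); last by lia.
  case uS : (u \in S); first by lia.
  rewrite leq_eqVlt => /orP[tS|]; last by lia.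
  have UT : M :|: S != setT.
    by apply/eqP => /setP/(_ u); rewrite !inE (negPf uM) uS.
  suff tU : tight (M :|: S).
    have /= := Mmax _ tU; rewrite leqNgt => /negP[]; apply: proper_card.
    by rewrite properE subsetUl /=; apply/subsetPn; exists v; rewrite ?inE ?vS ?orbT.
  rewrite /tight !inE (negPf uM) uS /= eqn_leq qS //=.
  have IT : M :&: S != setT.
    by apply/eqP => /setP/(_ u); rewrite !inE (negPf uM).
  have := qS _ IT; move/eqP: tS tM.
  have sub : (touching setT (M :|: S) + touching setT (M :&: S) <=
     touching setT M + touching setT S)%N.
    rewrite /touching -!big_split; apply: leq_sum => e _; rewrite /touch !inE.
    by case: (source e \in M); case: (source e \in S); case: (target e \in M);
      case: (target e \in S).
  have cS := cardsUI M S.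
  have qUI : (\sum_(x in M) q x + \sum_(x in S) q x =
     \sum_(x in M :|: S) q x + \sum_(x in M :&: S) q x)%N.
    rewrite !(big_mkcond (fun x => x \in _)) /= -!big_split; apply: eq_bigr => x _ /=.
    by rewrite !inE; case: (x \in M); case: (x \in S); rewrite ?addn0.
  move: sub cS qUI; clear; lia.
(* No receiver outside [M]: off [M] the total of [q'] is smaller because of [u], and on [M]
   tightness bounds it by that of [q], contradicting the equal sums. *)
have := qS' M MT; rewrite -tM leq_add2r => leM.
have : (\sum_v q' v < \sum_v q v)%N.
  rewrite (bigID (mem M)) [X in (_ < X)%N](bigID (mem M)) /= -addnS; apply: leq_add => //.
  have sumC (f : V -> nat) : (\sum_(x | x \notin M) f x = \sum_(x in ~: M) f x)%N.
    by apply: eq_bigl => x; rewrite inE.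
  rewrite !sumC; apply: q_sub => [|v]; first by rewrite inE.
  by rewrite inE => vM _; have := H v; rewrite vM -leqNgt.
by move: sq sq'; clear; lia.
Qed.

Lemma break_m_convex : m_convex (#|E|.+1 - #|V|) break_list.
Proof.
split; last exact: break_exchange.
  apply: filter_uniq; rewrite map_inj_uniq ?enum_uniq // => f g fg.
  apply/ffunP => v; apply: val_inj; have /ffunP/(_ v) := fg.
  by rewrite !ffunE.
by move=> q; rewrite mem_break_list => /break_vectorP[<- _]; rewrite addnK.
Qed.

End BreakVectors.

Section SpanningTree.
Variable G : digraph.
Hypothesis loopless : forall e : edge G, source e != target e.
Local Notation V := (vert G).
Local Notation E := (edge G).

Lemma crossing_edge (F : {set E}) (S : {set V}) u v : connect (adjacent F) u v ->
  u \in S -> v \notin S -> exists2 e, e \in F & (source e \in S) != (target e \in S).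
Proof.
case/connectP => p; elim: p u => [|x p IH] u /=.
  by move=> _ -> uS; rewrite uS.
case/andP => /existsP[e /andP[eF ux]] xp vp uS vS.
have [xS|xS] := boolP (x \in S); first exact: IH xp vp xS vS.
by exists e => //; case/orP: ux => /andP[/eqP -> /eqP ->]; rewrite uS (negPf xS).
Qed.

(** A largest acyclic set works: if it missed a connection, an edge crossing the resulting cut could
    be added, because a cycle through it would have nonzero flow across that cut. *)
Lemma spanning_tree_exists : connected_graph G -> exists T : {set E}, spanning_tree T.
Proof.
move=> [V0 conn].
have ac0 : `[< acyclic (set0 : {set E}) >].
  apply/asboolP => C [k [w [c [_ _ _ ->]]]]; apply/subsetPn; exists (c ord0).
    exact: imset_f.
  by rewrite inE.
have [F /asboolP acF Fmax] :=
  @arg_maxnP _ (set0 : {set E}) (fun F => `[< acyclic F >]) (fun F => #|F|) ac0.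
exists F; split=> //; split=> // u v; apply: contraT => nuv.
pose S := [set x | connect (adjacent F) u x].
have [e _ eS] : exists2 e, e \in [set: E] & (source e \in S) != (target e \in S).
  by apply: crossing_edge (conn u v) _ _; rewrite inE ?connect0.
have cross e' : e' \in F -> (source e' \in S) = (target e' \in S).
  move=> e'F; rewrite !inE.
  have adj : forall x y, joins e' x y -> adjacent F x y.
    by move=> x y xy; apply/existsP; exists e'; rewrite e'F.
  by apply/idP/idP => H; apply: connect_trans H (connect1 _); apply: adj;
    rewrite /joins !eqxx ?orbT.
have eF : e \notin F by apply: contra eS => /cross ->.
suff acFe : `[< acyclic (e |: F) >].
  by have /= := Fmax _ acFe; rewrite cardsU1 eF add1n ltnn.
apply/asboolP => C cC; apply/negP => CF.
have [lam [lb lC lout]] := cycle_dependence cC.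
have eC : e \in C.
  have := acF C cC; apply: contraNT => eC; apply/subsetP => e' e'C.
  have := subsetP CF e' e'C; rewrite in_setU1 => /orP[/eqP ee|//].
  by rewrite -ee e'C in eC.
have := cut_boundary S lam; rewrite big1 => [|x _]; last exact: lb.
rewrite (bigD1 e) //= [X in _ + X]big1 => [|e' ne]; last first.
  have [e'C|/lout ->] := boolP (e' \in C); last by rewrite mul0r.
  have := subsetP CF e' e'C; rewrite in_setU1 (negPf ne) => /cross ->.
  by rewrite subrr mulr0.
have le : lam e != 0 by apply/eqP => l0; have := lC e eC; rewrite l0 normr0.
move/esym/eqP; rewrite addr0 mulf_eq0 (negPf le) /=.
by case: (source e \in S) eS; case: (target e \in S).
Qed.

End SpanningTree.

(** * Coefficients as numbers of break vectors *)

Section Coefficients.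
Variables (R : realType) (G : digraph) (V1 V2 : {set vert G}) (rho : {ffun edge G -> R}).
Hypothesis connG : connected_graph G.
Hypothesis bip : directed_bipartition V1 V2.
Hypothesis generic_rho : generic rho.
Local Notation V := (vert G).
Local Notation E := (edge G).
Implicit Types (T : {set E}).

Definition genus : nat := (#|E|.+1 - #|V|)%N.

Lemma bipartition_target e : target e \notin V1.
Proof.
by case: bip => _ dis /(_ e)[_ te]; have /disjointFl -> := dis.
Qed.

Lemma bipartition_source e : source e \in V1.
Proof. by case: bip => _ _ /(_ e)[]. Qed.

Lemma bipartition_loopless (e : E) : source e != target e.
Proof. by apply: contraNneq (bipartition_target e) => <-; exact: bipartition_source. Qed.

Definition break_count i : nat :=
  count (fun q : {ffun V -> nat} => \sum_(v in V1) q v == i)%N (break_list G).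

(** Sources lie in [V1] and targets do not, so an edge outside [T] is counted in [V1] exactly when
    its chosen endpoint is its source. *)
Lemma endpoint_source T (A : {set E}) : [disjoint T & A] ->
  (\sum_(v in V1) endpoint_vector T A v = #|A|)%N.
Proof.
move=> TA; rewrite endpoint_sum // -sum1_card big_mkcond [RHS]big_mkcond /=.
apply: eq_bigr => e _; rewrite inE bipartition_source (negPf (bipartition_target e)).
by case eA : (e \in A); [rewrite (disjointFl TA) | case: ifP].
Qed.

Lemma ext_disjoint T : [disjoint T & ext_edges rho T].
Proof.
rewrite disjoint_sym disjoints_subset; apply/subsetP => e /ext_edges_out.
by rewrite inE.
Qed.

Lemma coef_f_poly i : (f_poly rho)`_i = (break_count i)%:R.
Proof.
have loopless := bipartition_loopless.
pose A := [set T : {set E} | `[< spanning_tree T >] && (ext rho T == i)].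
have extE T : ext rho T = (\sum_(v in V1) tree_vector rho T v)%N.
  by rewrite endpoint_source ?ext_disjoint.
have -> : (f_poly rho)`_i = #|A|%:R.
  rewrite /f_poly coef_sum -sum1_card natr_sum big_mkcond [RHS]big_mkcond.
  apply: eq_bigr => T _; rewrite inE coefXn eq_sym.
  by case: `[< _ >] => //=; case: eqP.
congr _%:R; rewrite /break_count -size_filter cardE -(size_map (tree_vector rho)).
apply: perm_size; apply: uniq_perm.
- rewrite map_inj_in_uniq ?enum_uniq // => T T'; rewrite !mem_enum !inE.
  by move=> /andP[/asboolP tT _] /andP[/asboolP tT' _]; exact: tree_vector_inj.
- by apply: filter_uniq; have [] := break_m_convex G.
move=> q; rewrite mem_filter mem_break_list; apply/mapP/andP.
  move=> [T]; rewrite mem_enum inE => /andP[/asboolP tT /eqP eT] ->.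
  split; first by rewrite -extE eT.
  exact: endpoint_break (ext_disjoint T).
move=> [/eqP qi /break_vector_feasible fq].
have [X fX] := fq loopless.
have [T tT Tq] := tree_vector_surj loopless generic_rho (proj1 connG) fX.
exists T => //; rewrite mem_enum inE; apply/andP; split; first exact/asboolP.
by rewrite extE Tq qi.
Qed.

Lemma break_count_gt0 i : (i <= genus)%N -> (0 < break_count i)%N.
Proof.
have loopless := bipartition_loopless.
have [T tT] := spanning_tree_exists connG.
have tc := tree_card loopless tT.
move=> ig; have iT : (i <= #|~: T|)%N.
  by have := cardsC T; move: ig; rewrite /genus -tc; lia.
have [A [AT Ai]] : exists A : {set E}, A \subset ~: T /\ #|A| = i.
  exists [set e in take i (enum (~: T))]; split.
    by apply/subsetP => e; rewrite inE => /mem_take; rewrite mem_enum.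
  rewrite cardsE (card_uniqP _) ?take_uniq ?enum_uniq // size_takel //.
  by rewrite -cardE.
have TA : [disjoint T & A].
  by rewrite disjoint_sym disjoints_subset.
rewrite -has_count; apply/hasP; exists (endpoint_vector T A).
  by rewrite mem_break_list endpoint_break.
by rewrite endpoint_source ?Ai.
Qed.

Lemma break_count_out i : (genus < i)%N -> break_count i = 0%N.
Proof.
move=> ig; apply/eqP; rewrite -leqn0 leqNgt -has_count; apply/hasPn => q qJ.
have [_ /(_ q qJ) sq _] := break_m_convex G.
apply/negP => /eqP qi; move: ig; rewrite -qi ltnNge -/genus /genus -sq.
by rewrite [X in (_ <= X)%N](bigID (mem V1)) /= leq_addr.
Qed.

Lemma size_f_poly : size (f_poly rho) = genus.+1.
Proof.
apply/eqP; rewrite eqn_leq; apply/andP; split.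
  by apply/leq_sizeP => i ig; rewrite coef_f_poly break_count_out.
rewrite ltnNge; apply/negP => /leq_sizeP/(_ genus (leqnn _)).
rewrite coef_f_poly => /eqP; rewrite pnatr_eq0.
by rewrite -leqn0 leqNgt break_count_gt0.
Qed.

Lemma break_count_log_concave i : (0 < i < genus)%N ->
  (break_count i.-1 * break_count i.+1 <= break_count i ^ 2)%N.
Proof.
case/andP => i0 ig.
pose side v := v \in V1.
have [e _] : exists e : E, true.
  have : (0 < #|E|)%N by move: ig i0 (proj1 connG); rewrite /genus; lia.
  by case/card_gt0P => e _; exists e.
have c1 : (0 < side_card side setT true)%N.
  by apply/card_gt0P; exists (source e); rewrite !inE /side bipartition_source.
have c2 : (0 < side_card side setT false)%N.
  by apply/card_gt0P; exists (target e); rewrite !inE /side (negPf (bipartition_target e)).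
set n1 := side_card side setT true in c1 *.
set n2 := side_card side setT false in c2 *.
(* The exponents of N_i are [i + n1 - 1] and [genus - i + n2 - 1]; one derivative of each kind is
   held back. Adding two of side [V2], one of each, or two of side [V1] selects [i.-1], [i] or
   [i.+1]. The bounds on [i] keep the subtractions exact. *)
pose bs := nseq (i + n1 - 2) true ++ nseq (genus - i + n2 - 2) false.
have mJ := break_m_convex G.
have cnt (b1 b2 : bool) j : (j + n1 = i + n1 - 2 + b1 + b2 + 1)%N ->
    count (fits side setT (foldl raise [ffun=> 0%N] [:: b1, b2 & bs])) (break_list G) =
      break_count j.
  move=> jE; apply: eq_in_count => q qJ.
  have [_ /(_ q qJ) sq _] := mJ.
  rewrite raise_count /fits.
  have -> : [forall v, (v \notin setT) ==> (q v == 0%N)].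
    by apply/forallP => v; rewrite inE.
  have shiftedE b : (shifted_sum side setT b q =
      \sum_(v | side v == b) q v + side_card side setT b)%N.
    rewrite /side_card -sum1dep_card.
    rewrite [X in (X + _)%N](eq_bigl (fun v => (v \in [set: V]) && (side v == b))).
      by rewrite -big_split /=; apply: eq_bigr => v _; rewrite addn1.
    by move=> v; rewrite inE.
  have S1 : (shifted_sum side setT true q = \sum_(v in V1) q v + n1)%N.
    by rewrite shiftedE; congr (_ + _)%N; apply: eq_bigl => v; rewrite eqb_id.
  have S2 : (shifted_sum side setT false q = \sum_(v | v \notin V1) q v + n2)%N.
    by rewrite shiftedE; congr (_ + _)%N; apply: eq_bigl => v; rewrite eqbF_neg.
  have sE : (\sum_(v in V1) q v + \sum_(v | v \notin V1) q v = genus)%N.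
    by rewrite -/genus in sq; rewrite -sq [in RHS](bigID (mem V1)).
  have ct : count_mem true [:: b1, b2 & bs] = (b1 + b2 + (i + n1 - 2))%N.
    by rewrite /= count_cat !count_nseq /= mul1n mul0n addn0 !eqb_id addnA.
  have cf : count_mem false [:: b1, b2 & bs] = (~~ b1 + ~~ b2 + (genus - i + n2 - 2))%N.
    by rewrite /= count_cat !count_nseq /= mul1n mul0n add0n !eqbF_neg addnA.
  apply/forallP/eqP => [/(_ true)|sj b].
    rewrite ffunE ct S1 ffunE => /eqP; move: jE; clear; case: b1; case: b2 => /=; lia.
  rewrite ffunE ffunE; case: b; first by rewrite ct S1 sj; apply/eqP; move: jE; clear; case: b1;
    case: b2 => /=; lia.
  rewrite cf S2; apply/eqP; move: jE sE i0 ig c1 c2; rewrite sj.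
  by clear; case: b1; case: b2 => /=; lia.
have sz : (genus + side_card side setT false + side_card side setT true = size bs + 4)%N.
  rewrite size_cat !size_nseq -/n1 -/n2; move: i0 ig c1 c2; clear; lia.
have := count_fits_log_concave false true mJ sz.
rewrite (cnt false false i.-1) ?(cnt true true i.+1) ?(cnt false true i) //=;
  by move: i0 c1; clear; lia.
Qed.

End Coefficients.

Theorem theorem2 (R : realType) (G : digraph) (V1 V2 : {set vert G})
    (rho : {ffun edge G -> R}) :
  connected_graph G -> directed_bipartition V1 V2 -> generic rho ->
  log_concave (f_poly rho) /\ trapezoidal (f_poly rho).
Proof.
move=> connG bip generic_rho.
have coefE := coef_f_poly connG bip generic_rho.
have sizeE := size_f_poly connG bip generic_rho.
have lc : log_concave (f_poly rho).
  move=> i; rewrite sizeE => /(break_count_log_concave connG bip).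
  by rewrite !coefE -natrM -natrX ler_nat.
split=> //; apply: log_concave_trapezoidal lc => i; rewrite sizeE => ig.
by rewrite coefE ltr0n (break_count_gt0 connG bip).
Qed.
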